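(* Let $\mathcal X=\prod_{i=1}^d\Delta_{n_i}$ and let $f:\mathcal X\to\mathbb R$ satisfy the generalized quasar-convexity (GQC) condition with respect to a minimizer $\boldsymbol x^*$, with internal function $\boldsymbol F$ and parameters $\gamma_1,\dots,\gamma_d>0$. Let $N=\max_{i\in[1:d]}n_i$. Suppose there exist $\Theta_1,\Theta_2>0$, a positive integer $K_0$, $\theta\in[0,1)$ and a fixed $\boldsymbol y\in\mathbb R^{\sum_i n_i}$ such that (A1) $\|\boldsymbol R^{\boldsymbol F}_{K,\boldsymbol y}(\boldsymbol x)\|_\infty\le\Theta_1\theta^K$ for every integer $K>K_0$ and every $\boldsymbol x\in\mathcal X$; (A2) $\|\boldsymbol P^{\boldsymbol F}_{K,\boldsymbol y}(\boldsymbol x)\|_\infty\le\Theta_2$ for every positive integer $K$ and every $\boldsymbol x\in\mathcal X$. Let $T\ge4$ and set $$\Theta=\Theta_1+\Theta_2+1,\quad H=\lceil\log T\rceil,\quad \beta_0=\frac1{4H},\quad \beta=\min\left\{\frac{\sqrt{\beta_0/8}}{H^3},\frac1{2\Theta(H+3)}\right\},\quad \Gamma=e^2+322560\,\Theta_2,$$ $$\hat K=\max\left\{\frac{H\log(4\beta^{-1})+\log\Theta_1}{\log(\theta^{-1})},K_0\right\},\qquad \eta=\min\left\{\frac{\beta}{6e^3\hat K\Gamma\max\{\Theta,1\}},\frac{\beta_0^4}{57792\,\Theta}\right\}$$ (with the first entry of $\hat K$ read as $0$ if $\theta=0$). Then the iterates $\boldsymbol x^1,\dots,\boldsymbol x^T$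 of Optimistic Mirror Descent for Multi-Distributions with step size $\eta$ satisfy $$\frac1T\sum_{t=1}^T\big(f(\boldsymbol x^t)-f(\boldsymbol x^* )\big)\le\left(\sum_{i=1}^d\frac1{\gamma_i}\right)\left[\frac1\eta\log N+\eta\,\Theta^3\,(6+330240\,\Theta H^5)\right]T^{-1}.$$
   Context: $\Delta_n$ is the probability simplex in $\mathbb R^n$; $\boldsymbol x=(\boldsymbol x_1,\dots,\boldsymbol x_d)$ with $\boldsymbol x_i\in\Delta_{n_i}$; $\log$ is the natural logarithm. GQC: $f$ is generalized quasar-convex on $\mathcal X$ with respect to a minimizer $\boldsymbol x^*$ if there are $\boldsymbol F_i:\mathcal X\to\mathbb R^{n_i}$ and positive scalars $\gamma_i$ such that for all $\boldsymbol x\in\mathcal X$, $f(\boldsymbol x^* )\ge f(\boldsymbol x)+\sum_{i=1}^d\frac1{\gamma_i}\langle\boldsymbol F_i(\boldsymbol x),\boldsymbol x_i^*-\boldsymbol x_i\rangle$; $\boldsymbol F=(\boldsymbol F_1^\top,\dots,\boldsymbol F_d^\top)^\top$ is the internal function. Taylor notation: $\boldsymbol F$ is understood as a smooth function on an open set containing $\mathcal X$ and $\boldsymbol y$. For a smooth scalar function $\phi$, $$R^{\phi}_{K,\boldsymbol y}(\boldsymbol x)=\phi(\boldsymbol x)-\sum_{i=0}^K\sum_{|\boldsymbol\alpha|=i}\frac{D^{\boldsymbol\alpha}\phi(\boldsymbol y)}{\boldsymbol\alpha!}(\boldsymbol x-\boldsymbol y)^{\boldsymbol\alpha},\qquad P^{\phi}_{K,\boldsymbol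 y}(\boldsymbol x)=\sum_{i=0}^K\sum_{|\boldsymbol\alpha|=i}\frac{|D^{\boldsymbol\alpha}\phi(\boldsymbol y)|}{\boldsymbol\alpha!}(|\boldsymbol x|+|\boldsymbol y|)^{\boldsymbol\alpha},$$ with multi-indices $\boldsymbol\alpha$ and coordinatewise absolute values; $\boldsymbol R^{\boldsymbol F}_{K,\boldsymbol y}$, $\boldsymbol P^{\boldsymbol F}_{K,\boldsymbol y}$ are the vectors of these quantities for the scalar components of $\boldsymbol F$. Algorithm (Optimistic Mirror Descent for Multi-Distributions): start from $\boldsymbol g_i^0=\boldsymbol x_i^0=(1/n_i,\dots,1/n_i)$; for $t=1,\dots,T$ and every $i\in[1:d]$, $$\boldsymbol x_i^t=\arg\min_{\boldsymbol x_i\in\Delta_{n_i}}\eta\langle\boldsymbol F_i(\boldsymbol x^{t-1}),\boldsymbol x_i\rangle+\mathrm{KL}(\boldsymbol x_i\|\boldsymbol g_i^{t-1}),\qquad \boldsymbol g_i^t=\arg\min_{\boldsymbol g_i\in\Delta_{n_i}}\eta\langle\boldsymbol F_i(\boldsymbol x^t),\boldsymbol g_i\rangle+\mathrm{KL}(\boldsymbol g_i\|\boldsymbol g_i^{t-1}),$$ where $\mathrm{KL}(\boldsymbol p\|\boldsymbol q)=\sum_j\boldsymbol p(j)\log(\boldsymbol p(j)/\boldsymbol q(j))$. *)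

(* Defs.v *)
From HB Require Import structures.
From mathcomp Require Import all_boot all_order all_algebra.
From mathcomp Require Import all_classical all_reals all_analysis.
Import Order.TTheory GRing.Theory Num.Theory.
Import numFieldNormedType.Exports.

Set Implicit Arguments.
Unset Strict Implicit.
Unset Printing Implicit Defensive.

Local Open Scope classical_set_scope.
Local Open Scope ring_scope.

(* A point of prod_i R^(n i) is the concatenated row vector
   x : 'rV[R]_(\sum_i n i); its i-th block is [submxrow x i : 'rV[R]_(n i)]. *)

Definition simplex (R : realType) (k : nat) : set 'rV[R]_k :=
  [set p | (forall j, 0 <= p 0 j) /\ \sum_j p 0 j = 1].

Definition simplices (R : realType) (d : nat) (n : 'I_d -> nat) :
    set 'rV[R]_(\sum_i n i) :=
  [set x | forall i, simplex (submxrow x i)].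

Definition inner (R : realType) (k : nat) (u v : 'rV[R]_k) : R :=
  \sum_j u 0 j * v 0 j.

(* 0 log 0 = 0 holds since [0 * _ = 0].  The other convention, p log (p / 0) = +oo
   for p > 0, is not encoded: below, the second argument starts at the uniform
   distribution and every mirror step keeps it positive in each coordinate. *)
Definition KL (R : realType) (k : nat) (p q : 'rV[R]_k) : R :=
  \sum_j p 0 j * ln (p 0 j / q 0 j).

Definition is_argmin (R : realType) (V : Type) (A : set V) (h : V -> R) (p : V) :
    Prop :=
  A p /\ forall q, A q -> h p <= h q.

Definition gqc (R : realType) (d : nat) (n : 'I_d -> nat)
    (f : 'rV[R]_(\sum_i n i) -> R) (xstar : 'rV[R]_(\sum_i n i))
    (F : 'rV[R]_(\sum_i n i) -> 'rV[R]_(\sum_i n i)) (gamma : 'I_d -> R) : Prop :=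
  [/\ is_argmin (@simplices R d n) f xstar,
      forall i, 0 < gamma i
    & forall x, simplices x ->
        f x + \sum_i (gamma i)^-1 *
                inner (submxrow (F x) i) (submxrow xstar i - submxrow x i)
        <= f xstar].

Section Taylor.
Context {R : realType} {m : nat}.
Implicit Types (phi : 'rV[R]_m -> R) (x y : 'rV[R]_m).

Definition partial (j : 'I_m) phi : 'rV[R]_m -> R :=
  fun x => 'D_(delta_mx 0 j) phi x.

Definition partials (s : seq 'I_m) phi : 'rV[R]_m -> R := foldr partial phi s.

Definition smooth_on (U : set 'rV[R]_m) phi : Prop :=
  forall (s : seq 'I_m) x, U x ->
    {for x, continuous (partials s phi)} /\
    forall j, derivable (partials s phi) x (delta_mx 0 j).

Definition mderive (alpha : 'I_m -> nat) phi : 'rV[R]_m -> R :=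
  partials (flatten [seq nseq (alpha j) j | j <- enum 'I_m]) phi.

Definition mfact (alpha : 'I_m -> nat) : nat := (\prod_j (alpha j)`!)%N.

Definition mpow x (alpha : 'I_m -> nat) : R := \prod_j x 0 j ^+ alpha j.

(* A multi-index of weight i has all its entries at most i, so the multi-indices
   of weight i are the functions into 'I_i.+1 of weight i. *)
Definition taylor_R phi (K : nat) y x : R :=
  phi x - \sum_(0 <= i < K.+1)
            \sum_(alpha : {ffun 'I_m -> 'I_i.+1} | (\sum_j alpha j == i)%N)
              let a j : nat := alpha j in
              mderive a phi y / (mfact a)%:R * mpow (x - y) a.

Definition taylor_P phi (K : nat) y x : R :=
  \sum_(0 <= i < K.+1)
    \sum_(alpha : {ffun 'I_m -> 'I_i.+1} | (\sum_j alpha j == i)%N)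
      let a j : nat := alpha j in
      `|mderive a phi y| / (mfact a)%:R *
        mpow (map_mx Num.norm x + map_mx Num.norm y) a.

Definition taylor_Rvec (F : 'rV[R]_m -> 'rV[R]_m) (K : nat) y x : 'rV[R]_m :=
  \row_j taylor_R (fun z => F z 0 j) K y x.

Definition taylor_Pvec (F : 'rV[R]_m -> 'rV[R]_m) (K : nat) y x : 'rV[R]_m :=
  \row_j taylor_P (fun z => F z 0 j) K y x.

End Taylor.

Definition mirror_step (R : realType) (k : nat) (eta : R) (v g p : 'rV[R]_k) : Prop :=
  is_argmin (@simplex R k) (fun q => eta * inner v q + KL q g) p.

Definition omd_iterates (R : realType) (d : nat) (n : 'I_d -> nat)
    (F : 'rV[R]_(\sum_i n i) -> 'rV[R]_(\sum_i n i)) (eta : R) (T : nat)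
    (x g : nat -> 'rV[R]_(\sum_i n i)) : Prop :=
  (forall i, submxrow (x 0%N) i = const_mx (n i)%:R^-1 /\
             submxrow (g 0%N) i = const_mx (n i)%:R^-1) /\
  (forall t, (1 <= t <= T)%N -> forall i,
     mirror_step eta (submxrow (F (x t.-1)) i) (submxrow (g t.-1) i)
       (submxrow (x t) i) /\
     mirror_step eta (submxrow (F (x t)) i) (submxrow (g t.-1) i)
       (submxrow (g t) i)).

(* Main.v *)
Require Import Defs.
From HB Require Import structures.
From mathcomp Require Import all_boot all_order all_algebra.
From mathcomp Require Import all_classical all_reals all_analysis.
From mathcomp Require Import zify ring lra.
Import Order.TTheory GRing.Theory Num.Theory.
Import numFieldNormedType.Exports.
Local Open Scope classical_set_scope.
Local Open Scope ring_scope.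

Set Implicit Arguments.
Unset Strict Implicit.
Unset Printing Implicit Defensive.

(** The mirror steps have closed forms: if [tilt p v] is the distribution
    proportional to [p * exp v], then blockwise
      [x_(t+1) = tilt g_t (- eta F(x_t))],  [g_(t+1) = tilt g_t (- eta F(x_(t+1)))].
    By generalized quasar-convexity the gap [f (x t) - f xstar] is at most the
    sum over the blocks, weighted by the inverse gammas, of the instantaneous
    regrets, so it suffices to bound the regret of every block separately,
    by [ln n / eta] plus eta times a polynomial in H = ceil (ln T).

    Regret ([omd_regret]).  Comparing logarithms of normalizing constants, the
    regret of a block is at most [ln n / eta] plus eta times the sum over t of
      [Var_(x_(t+1)) (l_(t+1) - l_t) - Var_(x_(t+1)) (l_t) / 5],
    where [l_t = F(x_t)].  It is thus enough to dominate the sum of the first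
    variances by an eighth of the sum of the second ones, up to a constant.

    Interpolation ([energy_contraction]).  Let [A_h] be the sum over t of the
    variances of the h-th finite differences of [l].  Summation by parts gives
    [A_(h+1) <= sqrt (A_h A_(h+2))] up to boundary terms and the slow variation
    of the weights [x_t].  So the ratios [A_(h+1) / A_h] are essentially
    nondecreasing in h: if [A_1 > A_0 / 8], then [A_H > A_0 / 8 ^ H], which forces
    [A_0] to be bounded when [A_H] is tiny.  Quantitatively,
    [A_(h+1) <= rho_h A_h + C / 64 ^ h] with rho_h between 1/16 and 1/8, by
    downward induction from h = H - 1; as T <= 4 ^ H, the induction starts as
    soon as the h-th differences are at most [M / 32 ^ h].

    Smoothness of high order ([finite_difference_bound]).  On a window of
    consecutive times the quantity
      [wnorm r h u = sum_(k <= h) r ^ k / k! * max |Delta^k u|]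
    is a submultiplicative norm, by the Leibniz rule.  So exponentials, quotients
    and power series of sequences are bounded by their scalar majorants, exactly
    as for analytic functions.  Inside a window [x] is a tilt of its first value,
    and the exponent is eta times a discrete primitive of combinations of F(x_t).
    Taking a primitive costs a factor r and gains one order of difference; since
    eta * r is small, induction on the order yields [wnorm <= 2 Theta] with
    r = 1 / beta.  This is where the Taylor hypotheses enter: the polynomial of
    degree K is majorized by [(1 + small) ^ K * Theta2], and K is chosen so that
    the remainder is negligible even after H differences.  From
    [|Delta^h l| <= 2 Theta h! beta ^ h] and [H beta <= 1 / 32] the bound used by
    the interpolation follows. *)

(** * Finite differences and a submultiplicative norm on windows *)

Section FiniteDifferences.
Context {R : realType}.
Implicit Types (u v : nat -> R) (h k s : nat) (r : R).

Definition fdiff u : nat -> R := fun s => u s.+1 - u s.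

Lemma fdiffS k u s :
  iter k.+1 fdiff u s = iter k fdiff u s.+1 - iter k fdiff u s.
Proof. by []. Qed.

Lemma fdiffSr k u : iter k.+1 fdiff u = iter k fdiff (fdiff u).
Proof. exact: iterSr. Qed.

Lemma fdiffD k u v s :
  iter k fdiff (fun i => u i + v i) s = iter k fdiff u s + iter k fdiff v s.
Proof. by elim: k s => [//|k IH] s; rewrite !fdiffS !IH; ring. Qed.

Lemma fdiffZ k (c : R) u s :
  iter k fdiff (fun i => c * u i) s = c * iter k fdiff u s.
Proof. by elim: k s => [//|k IH] s; rewrite !fdiffS !IH; ring. Qed.

Lemma fdiff_cst k (c : R) s :
  iter k fdiff (fun=> c) s = if k == 0%N then c else 0.
Proof. by elim: k s => [//|[|k] IH] s; rewrite fdiffS !IH /= subrr. Qed.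

Lemma eq_fdiff k u v s : (forall i, (i <= s + k)%N -> u i = v i) ->
  iter k fdiff u s = iter k fdiff v s.
Proof.
elim: k s => [|k IH] s uv; first by rewrite /= uv ?addn0.
by rewrite !fdiffS !IH // => i hi; apply: uv; lia.
Qed.

Lemma fdiff_shift k a u s :
  iter k fdiff (fun i => u (a + i)%N) s = iter k fdiff u (a + s)%N.
Proof. by elim: k s => [//|k IH] s; rewrite !fdiffS !IH addnS. Qed.

Lemma fdiff_sup k u (B : R) s : (forall i, (i <= s + k)%N -> `|u i| <= B) ->
  `|iter k fdiff u s| <= 2 ^+ k * B.
Proof.
elim: k s => [|k IH] s uB; first by rewrite expr0 mul1r /= uB ?addn0.
rewrite fdiffS; apply: le_trans (ler_normB _ _) _.
have h1 : `|iter k fdiff u s.+1| <= 2 ^+ k * B.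
  by apply: IH => i hi; apply: uB; lia.
have h2 : `|iter k fdiff u s| <= 2 ^+ k * B.
  by apply: IH => i hi; apply: uB; lia.
rewrite exprS -mulrA mulr_natl mulr2n; exact: lerD.
Qed.

(** Newton's form of the Leibniz rule.  The argument of the second factor is
    shifted by i, so that a bound valid on a window of times for both factors
    still applies to every term. *)
Lemma fdiff_leibniz k u v s : iter k fdiff (fun i => u i * v i) s =
  \sum_(0 <= i < k.+1)
    'C(k, i)%:R * (iter i fdiff u s * iter (k - i) fdiff v (s + i)%N).
Proof.
elim: k s => [|k IH] s.
  by rewrite big_nat1 bin0 mul1r subnn /= addn0.
have split_diff i : (0 <= i < k.+1)%N ->
    'C(k, i)%:R * (iter i fdiff u s.+1 * iter (k - i) fdiff v (s.+1 + i)%N)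
    - 'C(k, i)%:R * (iter i fdiff u s * iter (k - i) fdiff v (s + i)%N)
  = 'C(k, i)%:R * (iter i.+1 fdiff u s * iter (k - i) fdiff v (s + i.+1)%N)
  + 'C(k, i)%:R * (iter i fdiff u s * iter (k.+1 - i) fdiff v (s + i)%N).
  by move=> ik; rewrite subSn // !fdiffS addSnnS addnS; ring.
rewrite fdiffS !IH -sumrB (eq_big_nat _ _ split_diff) big_split /=.
rewrite [RHS]big_nat_recl // bin0 addrC.
under [X in _ = _ + X]eq_bigr => i _ do rewrite subSS binS natrD mulrDl.
rewrite [X in _ = _ + X]big_split /= addrA; congr (_ + _).
rewrite [LHS]big_nat_recl // bin0; congr (_ + _).
by rewrite [RHS]big_nat_recr //= bin_small // mul0r addr0.
Qed.

(** The window is {0, ..., h}: a k-th difference based at s reads the values at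
    s, ..., s + k, whence the range s <= h - k. *)
Definition dmax h u k := \big[Num.max/0]_(s < (h - k).+1) `|iter k fdiff u s|.

Lemma dmax_ge0 h u k : 0 <= dmax h u k.
Proof. exact: bigmax_ge_id. Qed.

Lemma le_dmax h u k s : (s + k <= h)%N -> `|iter k fdiff u s| <= dmax h u k.
Proof.
move=> skh; have hs : (s < (h - k).+1)%N by lia.
exact: (le_bigmax 0 (fun i : 'I_(h - k).+1 => `|iter k fdiff u i|) (Ordinal hs)).
Qed.

Lemma dmax_le h u k (B : R) : (k <= h)%N -> 0 <= B ->
  (forall s, (s + k <= h)%N -> `|iter k fdiff u s| <= B) -> dmax h u k <= B.
Proof.
by move=> kh B0 uB; apply: bigmax_le => // i _; apply: uB; have := ltn_ord i; lia.
Qed.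

(** The exponential generating function of the suprema of the differences,
    truncated at order h and evaluated at r.  The factor 1 / k! turns the binomial
    coefficients of the Leibniz rule into a Cauchy product, which makes this a
    submultiplicative norm. *)
Definition wnorm r h u := \sum_(0 <= k < h.+1) r ^+ k / k`!%:R * dmax h u k.

Lemma eq_wnorm r h u v : (forall s, (s <= h)%N -> u s = v s) ->
  wnorm r h u = wnorm r h v.
Proof.
move=> uv; apply: eq_big_nat => k /andP[_ kh]; congr (_ * _).
apply: eq_bigr => s _; congr `|_|; apply: eq_fdiff => i hi; apply: uv.
by have := ltn_ord s; lia.
Qed.

Context (r : R) (r_ge0 : 0 <= r).
Implicit Types B : R.

Let coef_ge0 k : 0 <= r ^+ k / k`!%:R.
Proof. by rewrite divr_ge0 ?exprn_ge0. Qed.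

Lemma wnorm_ge0 h u : 0 <= wnorm r h u.
Proof. by apply: sumr_ge0 => k _; rewrite mulr_ge0 ?coef_ge0 ?dmax_ge0. Qed.

Lemma wnorm_le h u (c : nat -> R) :
  (forall k, 0 <= c k) ->
  (forall k s, (s + k <= h)%N -> `|iter k fdiff u s| <= c k) ->
  wnorm r h u <= \sum_(0 <= k < h.+1) r ^+ k / k`!%:R * c k.
Proof.
move=> c0 uc; rewrite /wnorm; apply: ler_sum_nat => k /andP[_ kh].
by rewrite ler_wpM2l ?coef_ge0 // dmax_le // => s; apply: uc.
Qed.

Lemma fdiff_le_wnorm h u k s : (s + k <= h)%N ->
  r ^+ k / k`!%:R * `|iter k fdiff u s| <= wnorm r h u.
Proof.
move=> skh; have kh : (k < h.+1)%N by lia.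
apply: (@le_trans _ _ (r ^+ k / k`!%:R * dmax h u k)).
  by rewrite ler_wpM2l ?coef_ge0 // le_dmax.
rewrite /wnorm big_mkord (bigD1 (Ordinal kh)) //= lerDl.
by apply: sumr_ge0 => i _; rewrite mulr_ge0 ?coef_ge0 ?dmax_ge0.
Qed.

Lemma wnormD h u v :
  wnorm r h (fun s => u s + v s) <= wnorm r h u + wnorm r h v.
Proof.
rewrite {2 3}/wnorm -big_split /=.
under [leRHS]eq_bigr => k _ do rewrite -mulrDr.
apply: wnorm_le => [k|k s ks]; first by rewrite addr_ge0 ?dmax_ge0.
by rewrite fdiffD (le_trans (ler_normD _ _)) // lerD ?le_dmax.
Qed.

Lemma wnormZ h (c : R) u : wnorm r h (fun s => c * u s) <= `|c| * wnorm r h u.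
Proof.
rewrite {2}/wnorm mulr_sumr; under [leRHS]eq_bigr => k _ do rewrite mulrCA.
apply: wnorm_le => [k|k s ks]; first by rewrite mulr_ge0 ?dmax_ge0.
by rewrite fdiffZ normrM ler_wpM2l ?le_dmax.
Qed.

Lemma wnorm_cst h (c : R) : wnorm r h (fun=> c) <= `|c|.
Proof.
apply: le_trans (wnorm_le (c := fun k => if k == 0%N then `|c| else 0) _ _) _.
- by move=> [|k].
- by move=> [|k] s _; rewrite fdiff_cst ?normr0.
rewrite big_nat_recl // expr0 fact0 divr1 mul1r big1_seq ?addr0 // => k _.
by rewrite mulr0.
Qed.

Let triangle_sum (a b : nat -> R) n : (forall k, 0 <= a k) -> (forall k, 0 <= b k) ->
  \sum_(0 <= k < n) \sum_(0 <= i < k.+1) a i * b (k - i)%N <=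
  (\sum_(0 <= k < n) a k) * (\sum_(0 <= k < n) b k).
Proof.
move=> a0 b0.
have -> : \sum_(0 <= k < n) \sum_(0 <= i < k.+1) a i * b (k - i)%N =
          \sum_(0 <= i < n) a i * \sum_(0 <= j < n - i) b j.
  elim: n => [|n IH]; first by rewrite !big_geq.
  rewrite big_nat_recr //= IH [RHS]big_nat_recr //=.
  rewrite subSnn big_nat1 [X in _ + X]big_nat_recr //= subnn addrA.
  congr (_ + _); rewrite -big_split /=; apply: eq_big_nat => i /andP[_ iltn].
  by rewrite subSn 1?ltnW // big_nat_recr //= mulrDr.
rewrite mulr_suml; apply: ler_sum_nat => i /andP[_ iltn]; rewrite ler_wpM2l //.
by rewrite [leRHS](@big_cat_nat _ _ _ (n - i)%N) ?leq_subr //= lerDl sumr_ge0.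
Qed.

(** The Cauchy product of the two generating functions, of which only the terms of
    total order at most h occur on the left. *)
Lemma wnormM h u v :
  wnorm r h (fun s => u s * v s) <= wnorm r h u * wnorm r h v.
Proof.
pose a k := r ^+ k / k`!%:R * dmax h u k.
pose b k := r ^+ k / k`!%:R * dmax h v k.
have a0 k : 0 <= a k by rewrite mulr_ge0 ?coef_ge0 ?dmax_ge0.
have b0 k : 0 <= b k by rewrite mulr_ge0 ?coef_ge0 ?dmax_ge0.
apply: le_trans (triangle_sum h.+1 a0 b0).
pose c k := \sum_(0 <= i < k.+1) 'C(k, i)%:R * (dmax h u i * dmax h v (k - i)).
apply: (@le_trans _ _ (\sum_(0 <= k < h.+1) r ^+ k / k`!%:R * c k)).
  apply: wnorm_le => [k|k s skh].
    by apply: sumr_ge0 => i _; rewrite mulr_ge0 ?mulr_ge0 ?dmax_ge0.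
  rewrite fdiff_leibniz; apply: le_trans (ler_norm_sum _ _ _) _.
  apply: ler_sum_nat => i /andP[_ ik].
  rewrite !normrM normr_nat ler_wpM2l ?ler_pM ?le_dmax //; lia.
apply: ler_sum_nat => k _; rewrite mulr_sumr; apply: ler_sum_nat => i /andP[_ ik].
rewrite le_eqVlt; apply/orP; left; apply/eqP.
have ki : (i <= k)%N by lia.
have fac : (k`! = 'C(k, i) * (i`! * (k - i)`!))%N by rewrite bin_fact.
rewrite /a /b fac !natrM -[in r ^+ k](subnKC ki) exprD; field.
by rewrite !pnatr_eq0 -!lt0n !fact_gt0 bin_gt0 ki.
Qed.

Lemma wnorm_sum h (I : Type) (s : seq I) (P : pred I) (u_ : I -> nat -> R) :
  wnorm r h (fun t => \sum_(i <- s | P i) u_ i t) <=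
  \sum_(i <- s | P i) wnorm r h (u_ i).
Proof.
elim: s => [|i s IH].
  rewrite big_nil (eq_wnorm r (v := fun=> 0)) => [|t _]; last by rewrite big_nil.
  by apply: le_trans (wnorm_cst _ _) _; rewrite normr0.
rewrite big_cons; case: ifPn => Pi.
  rewrite (eq_wnorm r (v := fun t => u_ i t + \sum_(i <- s | P i) u_ i t)).
    by apply: le_trans (wnormD _ _ _) _; rewrite lerD2l.
  by move=> t _; rewrite big_cons Pi.
rewrite (eq_wnorm r (v := fun t => \sum_(i <- s | P i) u_ i t)) // => t _.
by rewrite big_cons (negbTE Pi).
Qed.

Lemma wnormX h u k : wnorm r h (fun s => u s ^+ k) <= wnorm r h u ^+ k.
Proof.
elim: k => [|k IH].
  by apply: le_trans (wnorm_cst _ _) _; rewrite normr1.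
rewrite exprS (eq_wnorm r (v := fun s => u s * u s ^+ k)).
  by apply: le_trans (wnormM _ _ _) _; rewrite ler_wpM2l ?wnorm_ge0.
by move=> s _; rewrite exprS.
Qed.

Lemma wnorm_prod h (I : Type) (s : seq I) (u_ : I -> nat -> R) :
  wnorm r h (fun t => \prod_(i <- s) u_ i t) <= \prod_(i <- s) wnorm r h (u_ i).
Proof.
elim: s => [|i s IH].
  rewrite big_nil (eq_wnorm r (v := fun=> 1)) => [|t _]; last by rewrite big_nil.
  by apply: le_trans (wnorm_cst _ _) _; rewrite normr1.
rewrite big_cons (eq_wnorm r (v := fun t => u_ i t * \prod_(i <- s) u_ i t)).
  by apply: le_trans (wnormM _ _ _) _; rewrite ler_wpM2l ?wnorm_ge0.
by move=> t _; rewrite big_cons.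
Qed.

(** Used for the Taylor remainder, about whose differences nothing is known
    beyond the trivial growth by a factor 2 per order. *)
Lemma wnorm_sup h u B : 0 <= B -> (forall s, (s <= h)%N -> `|u s| <= B) ->
  wnorm r h u <= B * \sum_(0 <= k < h.+1) (2 * r) ^+ k / k`!%:R.
Proof.
move=> B0 uB; rewrite mulr_sumr.
apply: le_trans (wnorm_le (c := fun k => 2 ^+ k * B) _ _) _.
- by move=> k; rewrite mulr_ge0 ?exprn_ge0.
- by move=> k s sk; apply: fdiff_sup => i hi; apply: uB; lia.
apply: ler_sum => k _; rewrite exprMn le_eqVlt; apply/orP; left; apply/eqP.
by ring.
Qed.

(** The Neumann bound without a series: [1/u = 1 + (1 - u) / u] gives
    [|1/u| <= 1 + a |1/u|], and the norm is finite. *)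
Lemma wnorm_inv h u (a : R) : a < 1 -> (forall s, u s != 0) ->
  wnorm r h (fun s => 1 - u s) <= a ->
  wnorm r h (fun s => (u s)^-1) <= (1 - a)^-1.
Proof.
move=> a1 u0 ua; rewrite -div1r ler_pdivlMr ?subr_gt0 // mulrBr mulr1.
rewrite lerBlDr.
rewrite {1}(eq_wnorm r (v := fun s => 1 + (1 - u s) * (u s)^-1)).
  apply: le_trans (wnormD _ _ _) _; apply: lerD.
    by apply: le_trans (wnorm_cst _ _) _; rewrite normr1.
  by apply: le_trans (wnormM _ _ _) _; rewrite mulrC ler_wpM2l ?wnorm_ge0.
by move=> s _; rewrite mulrBl mul1r divff // addrC subrK.
Qed.

(** Passing from a sequence to its primitive costs one factor r and gains one
    order; the window of [fdiff u] is shorter by one.  This is what makes an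
    induction on the order possible. *)
Lemma wnorm_primitive h u B : 0 <= B -> (forall s, (s <= h.+1)%N -> `|u s| <= B) ->
  wnorm r h.+1 u <= B + r * wnorm r h (fdiff u).
Proof.
move=> B0 uB; rewrite /wnorm big_nat_recl // expr0 fact0 divr1 mul1r lerD //.
  by apply: dmax_le => // s hs; apply: uB; lia.
rewrite mulr_sumr; apply: ler_sum_nat => k /andP[_ kh].
have -> : dmax h.+1 u k.+1 = dmax h (fdiff u) k.
  by rewrite /dmax subSS; apply: eq_bigr => s _; rewrite fdiffSr.
rewrite mulrA ler_wpM2r ?dmax_ge0 // exprS mulrA ler_wpM2l ?mulr_ge0 ?exprn_ge0 //.
by rewrite lef_pV2 ?posrE ?ltr0n ?fact_gt0 // ler_nat factS leq_pmull.
Qed.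

Let sum_pow_le (a : R) m : 0 <= a < 1 -> \sum_(0 <= k < m) a ^+ k.+1 <= a / (1 - a).
Proof.
move=> /andP[a0 a1]; rewrite ler_pdivlMr ?subr_gt0 // big_mkord.
under eq_bigr => k _ do rewrite exprS.
rewrite -mulr_sumr -mulrA ler_piMr //.
have -> : (\sum_(i < m) a ^+ i) * (1 - a) = 1 - a ^+ m.
  by rewrite -(opprB (a ^+ m)) subrX1 -mulNr opprB mulrC.
by rewrite gerBl exprn_ge0.
Qed.

(** On a window only finitely many times matter, so the partial sums of the
    exponential series converge in the norm; each is bounded by a geometric sum. *)
Lemma wnorm_expR h u (a : R) : a < 1 -> wnorm r h u <= a ->
  wnorm r h (fun s => expR (u s) - 1) <= a / (1 - a).
Proof.
move=> a1 ua; have a0 : 0 <= a := le_trans (wnorm_ge0 h u) ua.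
set c := \sum_(0 <= k < h.+1) (2 * r) ^+ k / k`!%:R.
have c0 : 0 <= c.
  by apply: sumr_ge0 => k _; rewrite divr_ge0 ?exprn_ge0 ?mulr_ge0.
apply/ler_addgt0Pr => e e0.
(* [c] compares the norm with the supremum, so an error [d] costs at most [e]. *)
pose d := e / (c + 1).
have d0 : 0 < d by rewrite divr_gt0 // ltr_wpDl.
pose S m s := \sum_(0 <= k < m) u s ^+ k.+1 / k.+1`!%:R.
have [m Sm] : exists m, forall s : 'I_h.+1, `|expR (u s) - 1 - S m s| <= d.
  have : \forall m \near \oo, forall s : 'I_h.+1,
      `|expR (u s) - series (exp_coeff (u s)) m| < d.
    apply: filter_forall => s.
    have /cvgrPdist_lt/(_ _ d0) := is_cvg_series_exp_coeff (u s).
    by [].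
  case=> m _ mP; exists m => s.
  apply/ltW; rewrite -addrA -opprD; have := mP m.+1 (leqnSn m) s.
  rewrite /series /= /S big_nat_recl //.
  by rewrite {1}/exp_coeff /= expr0 fact0 divr1.
have -> : wnorm r h (fun s => expR (u s) - 1) =
          wnorm r h (fun s => S m s + (expR (u s) - 1 - S m s)).
  by apply: (eq_wnorm r) => s _; rewrite [RHS]addrC subrK.
apply: le_trans (wnormD _ _ _) _; apply: lerD.
  apply: le_trans (sum_pow_le m _); last by rewrite a0.
  apply: le_trans (wnorm_sum _ _ _ _) _; apply: ler_sum => k _.
  rewrite (eq_wnorm r (v := fun s => (k.+1`!%:R)^-1 * u s ^+ k.+1)); last first.
    by move=> s _; rewrite mulrC.
  apply: le_trans (wnormZ _ _ _) _.
  apply: (@le_trans _ _ (1 * wnorm r h (fun s => u s ^+ k.+1))).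
    rewrite ler_wpM2r ?wnorm_ge0 // normfV normr_nat invf_le1 ?ltr0n ?fact_gt0 //.
    by rewrite ler1n fact_gt0.
  rewrite mul1r; apply: le_trans (wnormX _ _ _) _.
  by rewrite lerXn2r ?nnegrE ?wnorm_ge0.
apply: le_trans (wnorm_sup (B := d) _ _) _.
- exact: ltW.
- by move=> s hs; exact: (Sm (Ordinal (hs : (s < h.+1)%N))).
rewrite -/c /d -mulrA ler_piMr ?ltW // mulrC ltr_pdivrMr ?mul1r ?ltrDl //.
by rewrite ltr_wpDl.
Qed.

End FiniteDifferences.

(** * Exponential tilting of distributions *)

Section Tilt.
Context {R : realType} {J : finType}.
Implicit Types (p v : J -> R).

(** The exponential reweighting of p by v, normalized: one mirror step for the
    Kullback-Leibler divergence. *)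
Definition tilt p v : J -> R :=
  fun j => p j * expR (v j) / \sum_k p k * expR (v k).

(** Strict positivity is part of the notion: the logarithms of all iterates are
    needed. *)
Definition distr p := (forall j, 0 < p j) /\ \sum_j p j = 1.

Lemma tilt_sum_gt0 p v : distr p -> 0 < \sum_k p k * expR (v k).
Proof.
move=> [p0 p1].
have [j _] : exists j : J, true.
  apply/existsP; apply: contraPT p1; rewrite negb_exists => /forallP J0.
  rewrite big_pred0 => [/eqP|j]; first by rewrite eq_sym oner_eq0.
  by have := J0 j.
rewrite (bigD1 j) //= ltr_wpDr ?mulr_gt0 ?expR_gt0 //.
by apply: sumr_ge0 => k _; rewrite mulr_ge0 ?ltW ?expR_gt0.
Qed.

Lemma tilt_distr p v : distr p -> distr (tilt p v).
Proof.
move=> dp; have Z0 := tilt_sum_gt0 v dp; case: (dp) => p0 _; split => [j|].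
  by rewrite divr_gt0 ?mulr_gt0 ?expR_gt0.
by rewrite /tilt -mulr_suml divff // gt_eqF.
Qed.

Lemma eq_distr p (q : J -> R) : p =1 q -> distr q -> distr p.
Proof.
move=> pq [q0 q1]; split=> [j|]; first by rewrite pq.
by rewrite (eq_bigr _ (fun j _ => pq j)).
Qed.

Lemma tilt_tilt p v w : distr p -> tilt (tilt p v) w =1 tilt p (fun j => v j + w j).
Proof.
move=> dp j; have Z0 := tilt_sum_gt0 v dp.
have Z1 := tilt_sum_gt0 (fun j => v j + w j) dp.
have tw k : tilt p v k * expR (w k) =
    (\sum_k p k * expR (v k))^-1 * (p k * expR (v k + w k)).
  by rewrite /tilt expRD; ring.
rewrite {1}/tilt tw (eq_bigr _ (fun k _ => tw k)) -mulr_sumr /tilt; field.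
by rewrite !gt_eqF.
Qed.

Lemma eq_tilt p p' v v' : p =1 p' -> v =1 v' -> tilt p v =1 tilt p' v'.
Proof.
move=> pp vv j; rewrite /tilt pp vv; congr (_ / _).
by apply: eq_bigr => k _; rewrite pp vv.
Qed.

Lemma tilt0 p : distr p -> tilt p (fun=> 0) =1 p.
Proof.
move=> [p0 p1] j; rewrite /tilt expR0 mulr1.
by under eq_bigr => k _ do rewrite mulr1; rewrite p1 divr1.
Qed.

(** Numerator and normalizing constant are both within a / (1 - a) of a constant
    in norm; submultiplicativity gives [(1 - a)^-1] for the former and
    [(1 - a) / (1 - 2 a)] for the inverse of the latter. *)
Lemma wnorm_tilt (r : R) h p (v : nat -> J -> R) (a : R) j :
  0 <= r -> distr p -> a < 1 / 2 ->
  (forall k, wnorm r h (fun s => v s k) <= a) ->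
  wnorm r h (fun s => tilt p (v s) j) <= p j / (1 - 2 * a).
Proof.
move=> r0 dp a12 va; case: (dp) => p0 p1.
have a0 : 0 <= a := le_trans (wnorm_ge0 r0 h _) (va j).
have a1 : a < 1 by lra.
have E1 k : wnorm r h (fun s => expR (v s k) - 1) <= a / (1 - a).
  exact: wnorm_expR.
have b1 : a / (1 - a) < 1 by rewrite ltr_pdivrMr; lra.
have Z1 : wnorm r h (fun s => 1 - \sum_k p k * expR (v s k)) <= a / (1 - a).
  rewrite (eq_wnorm r (v := fun s => \sum_k (- p k) * (expR (v s k) - 1))).
    apply: le_trans (wnorm_sum r0 _ _ _ _) _.
    have -> : a / (1 - a) = \sum_k p k * (a / (1 - a)).
      by rewrite -mulr_suml p1 mul1r.
    apply: ler_sum => k _; apply: le_trans (wnormZ r0 _ _ _) _.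
    by rewrite normrN gtr0_norm // ler_wpM2l // ltW.
  move=> s _; under [RHS]eq_bigr => k _ do rewrite mulrBr mulr1 opprK mulNr.
  by rewrite big_split /= p1 sumrN addrC.
have Zi := wnorm_inv r0 b1 (fun s => lt0r_neq0 (tilt_sum_gt0 (v s) dp)) Z1.
apply: (@le_trans _ _ ((p j * (1 + a / (1 - a))) * (1 - a / (1 - a))^-1)).
  apply: le_trans (wnormM r0 _ _ _) _.
  apply: ler_pM; [exact: wnorm_ge0|exact: wnorm_ge0| |exact: Zi].
  apply: le_trans (wnormZ r0 _ _ _) _.
  rewrite gtr0_norm //; apply: ler_wpM2l; first exact/ltW.
  rewrite (eq_wnorm r (v := fun s => 1 + (expR (v s j) - 1))).
    apply: le_trans (wnormD r0 _ _ _) _; apply: lerD => //.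
    by apply: le_trans (wnorm_cst r0 _ _) _; rewrite normr1.
  by move=> s _; rewrite [RHS]addrC subrK.
rewrite le_eqVlt; apply/orP; left; apply/eqP; field.
by rewrite !gt_eqF //=; lra.
Qed.

End Tilt.

(** * Variance and the logarithm of the moment generating function *)

Section LogMgf.
Context {R : realType}.

(** The square of [1 + x / 2 <= expR (x / 2)]; the constant 1/4 instead of 1/2 is
    good enough because the contraction factor below is 1/8. *)
Lemma expR_ge_quad (x : R) : -2 <= x -> 1 + x + x ^+ 2 / 4 <= expR x.
Proof.
move=> x2; have h : 1 + x / 2 <= expR (x / 2) := expR_ge1Dx _.
have -> : expR x = expR (x / 2) ^+ 2 by rewrite expr2 -expRD -splitr.
have -> : 1 + x + x ^+ 2 / 4 = (1 + x / 2) ^+ 2 by field.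
by rewrite lerXn2r // nnegrE; [lra|exact: expR_ge0].
Qed.

Lemma expR_le_quad (x : R) : `|x| <= 1 / 3 -> expR x <= 1 + x + x ^+ 2.
Proof.
rewrite ler_norml => /andP[xl xu].
have h : 1 - x + x ^+ 2 / 4 <= expR (- x).
  by have := @expR_ge_quad (- x); rewrite sqrrN; apply; lra.
have d0 : 0 < 1 - x + x ^+ 2 / 4 by nra.
have -> : expR x = (expR (- x))^-1 by rewrite expRN invrK.
apply: (@le_trans _ _ (1 - x + x ^+ 2 / 4)^-1).
  by rewrite lef_pV2 ?posrE ?expR_gt0.
rewrite -div1r ler_pdivrMr //.
have : 0 <= x ^+ 2 * ((1 - x) * (1 - 2 * x)).
  by apply: mulr_ge0; [exact: sqr_ge0|apply: mulr_ge0; lra].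
nra.
Qed.

Lemma ln_ge1V (y : R) : 0 < y -> 1 - y^-1 <= ln y.
Proof.
move=> y0; have yV0 : 0 < y^-1 by rewrite invr_gt0.
have : ln (1 + (y^-1 - 1)) <= y^-1 - 1 by apply: le_ln1Dx; lra.
by rewrite addrCA subrr addr0 lnV ?posrE //; lra.
Qed.

Lemma ln_lt_subr1 (y : R) : 0 < y -> y != 1 -> ln y < y - 1.
Proof.
move=> y0 y1; have : ln y != 0 by rewrite ln_eq0.
move/expR_gt1Dx; rewrite lnK ?posrE //; lra.
Qed.

Context {J : finType}.
Implicit Types (p u : J -> R).

(** The variance as an energy over pairs: nonnegative weights [p i * p j] and scalar
    differences.  In this form the weights can be compared at different times,
    while a centered form would also move the mean. *)
Definition fvariance p u := 2^-1 * \sum_i \sum_j p i * p j * (u i - u j) ^+ 2.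

Lemma fvarianceE p u : \sum_j p j = 1 ->
  fvariance p u = \sum_j p j * (u j - \sum_k p k * u k) ^+ 2.
Proof.
move=> p1; set m := \sum_k p k * u k; rewrite /fvariance.
have rhs : \sum_j p j * (u j - m) ^+ 2 = \sum_j p j * u j ^+ 2 - m ^+ 2.
  rewrite (eq_bigr (fun j => p j * u j ^+ 2 - 2 * m * (p j * u j) + m ^+ 2 * p j)).
    by rewrite big_split sumrB /= -!mulr_sumr p1 -/m; ring.
  by move=> j _; ring.
rewrite rhs.
rewrite (eq_bigr (fun i => p i * u i ^+ 2 - 2 * m * (p i * u i) +
    (\sum_j p j * u j ^+ 2) * p i)); last first.
  move=> i _.
  rewrite (eq_bigr (fun j => p i * u i ^+ 2 * p j - 2 * (p i * u i) * (p j * u j)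
    + p i * (p j * u j ^+ 2))); last by move=> j _; ring.
  by rewrite big_split sumrB /= -!mulr_sumr p1 -/m; ring.
by rewrite big_split sumrB /= -!mulr_sumr p1 -/m; field.
Qed.

Lemma fvarianceN p u : fvariance p (fun j => - u j) = fvariance p u.
Proof.
congr (_ * _); apply: eq_bigr => i _; apply: eq_bigr => j _.
by ring.
Qed.

Lemma fvarianceZ p u (c : R) : fvariance p (fun j => c * u j) = c ^+ 2 * fvariance p u.
Proof.
rewrite /fvariance mulrCA; congr (_ * _); rewrite mulr_sumr; apply: eq_bigr => i _.
by rewrite mulr_sumr; apply: eq_bigr => j _; ring.
Qed.

Lemma fvariance_ge0 p u : (forall j, 0 <= p j) -> 0 <= fvariance p u.
Proof.
move=> p0; apply: mulr_ge0; first by rewrite invr_ge0.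
apply: sumr_ge0 => i _; apply: sumr_ge0 => j _.
by apply: mulr_ge0; [exact: mulr_ge0|exact: sqr_ge0].
Qed.

Lemma mean_le p u (B : R) : distr p -> (forall j, `|u j| <= B) ->
  `|\sum_j p j * u j| <= B.
Proof.
move=> [p0 p1] uB; apply: le_trans (ler_norm_sum _ _ _) _.
have -> : B = \sum_j p j * B by rewrite -mulr_suml p1 mul1r.
by apply: ler_sum => j _; rewrite normrM gtr0_norm // ler_wpM2l // ltW.
Qed.

(** The cumulant generating function, minus its linear part, is comparable with
    the variance when the exponent is small.  The upper bound costs the regret a
    variance, the lower bound pays a fifth of one back. *)
Lemma ln_mgf p u : distr p -> (forall j, `|u j| <= 1 / 6) ->
  fvariance p u / 5 <= ln (\sum_j p j * expR (u j)) - \sum_j p j * u j <= fvariance p u.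
Proof.
move=> dp u6; case: (dp) => p0 p1; set m := \sum_j p j * u j.
have m6 : `|m| <= 1 / 6 by exact: mean_le.
have x3 j : `|u j - m| <= 1 / 3.
  by apply: le_trans (ler_normB _ _) _; have := u6 j; lra.
rewrite fvarianceE // -/m; set V := \sum_j _.
have V0 : 0 <= V.
  by apply: sumr_ge0 => j _; apply: mulr_ge0; [exact/ltW|exact: sqr_ge0].
(* the quadratic bounds apply to the centered exponent [u j - m] *)
have V1 : V <= 1.
  rewrite -p1; apply: ler_sum => j _; apply: ler_piMr; first exact/ltW.
  rewrite -[_ ^+ 2]ger0_norm ?sqr_ge0 // normrX; apply: exprn_ile1 => //.
  by apply: le_trans (x3 j) _; lra.
pose S := \sum_j p j * expR (u j - m).
have -> : \sum_j p j * expR (u j) = expR m * S.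
  rewrite mulr_sumr; apply: eq_bigr => j _.
  by rewrite mulrCA -expRD [m + _]addrC subrK.
have quad (c : R) : \sum_j p j * (1 + (u j - m) + c * (u j - m) ^+ 2) = 1 + c * V.
  rewrite (eq_bigr (fun j => p j + (p j * u j - m * p j) +
     c * (p j * (u j - m) ^+ 2))); last by move=> j _; ring.
  by rewrite big_split /= big_split /= sumrB -!mulr_sumr p1 -/m -/V; ring.
have SU : S <= 1 + V.
  rewrite -[V]mul1r -quad; apply: ler_sum => j _.
  by apply: ler_wpM2l; [exact/ltW|rewrite mul1r expR_le_quad].
have SL : 1 + V / 4 <= S.
  rewrite [V / 4]mulrC -quad; apply: ler_sum => j _.
  apply: ler_wpM2l; first exact/ltW.
  by rewrite [4^-1 * _]mulrC expR_ge_quad //; have := x3 j; rewrite ler_norml; lra.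
have S0 : 0 < S by lra.
rewrite lnM ?posrE ?expR_gt0 // expRK addrAC subrr add0r; apply/andP; split.
  apply: le_trans (ln_ge1V S0); rewrite lerBrDr.
  have : S^-1 <= (1 + V / 4)^-1 by rewrite lef_pV2 ?posrE //; lra.
  suff : (1 + V / 4)^-1 <= 1 - V / 5 by lra.
  by rewrite -div1r ler_pdivrMr; nra.
apply: (@le_trans _ _ (ln (1 + V))); first by rewrite ler_ln ?posrE //; lra.
by apply: le_ln1Dx; lra.
Qed.

End LogMgf.

(** * Closed form of a mirror step *)

Section MirrorStep.
Context {R : realType}.

(** Gibbs' variational principle: up to the constant [- ln Z] the objective at s is
    the divergence of s from the tilt, which is nonnegative and vanishes only
    there. *)
Lemma mirror_step_tilt (k : nat) (eta : R) (v g p : 'rV[R]_k) :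
  distr (g 0) -> mirror_step eta v g p ->
  p 0 =1 tilt (g 0) (fun j => - (eta * v 0 j)).
Proof.
move=> dg [[p0 p1] pmin]; set q := tilt _ _.
have dq : distr q := tilt_distr _ dg.
case: (dq) => q0 q1; case: (dg) => g0 g1.
set Z := \sum_k0 g 0 k0 * expR (- (eta * v 0 k0)).
have Z0 : 0 < Z := tilt_sum_gt0 _ dg.
have obj (s : 'rV[R]_k) : simplex s -> eta * inner v s + KL s g =
    (\sum_j s 0 j * ln (s 0 j / q j)) - ln Z.
  move=> [s0 s1]; rewrite -[ln Z]mul1r -s1 mulr_suml -sumrB /inner mulr_sumr.
  rewrite /KL -big_split /=; apply: eq_bigr => j _.
  have [->|sj] := eqVneq (s 0 j) 0; first by rewrite !(mul0r, mulr0) subr0 addr0.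
  have sj0 : 0 < s 0 j by rewrite lt_neqAle eq_sym sj s0.
  rewrite /q /tilt -/Z !ln_div ?posrE ?divr_gt0 ?mulr_gt0 ?expR_gt0 //.
  by rewrite lnM ?posrE ?expR_gt0 // expRK; ring.
have sq : simplex (\row_j q j).
  by split=> [j|]; [rewrite mxE ltW|under eq_bigr => j _ do rewrite mxE].
have := pmin _ sq; rewrite (obj p (conj p0 p1)) (obj _ sq).
rewrite lerD2r [leRHS]big1 => [KLp|j _]; last first.
  by rewrite mxE divff ?ln1 ?mulr0 // gt_eqF.
(* The added terms sum to zero and make every summand of the divergence
   nonnegative. *)
pose D j := p 0 j * ln (p 0 j / q j) - p 0 j + q j.
have D0 j : 0 <= D j.
  rewrite /D; have [->|pj] := eqVneq (p 0 j) 0.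
    by rewrite mul0r subr0 add0r ltW.
  have pj0 : 0 < p 0 j by rewrite lt_neqAle eq_sym pj p0.
  have := ln_ge1V (divr_gt0 pj0 (q0 j)); rewrite -(ler_pM2l pj0) invf_div.
  rewrite mulrBr mulr1 mulrCA divff // mulr1; lra.
have sD : \sum_j D j <= 0.
  by rewrite /D big_split sumrB /= p1 q1 subrK.
have /eqP : \sum_j D j = 0 by apply/le_anti; rewrite sD sumr_ge0.
rewrite psumr_eq0 // => /allP Deq j.
have /eqP := Deq j (mem_index_enum j); rewrite /D /=.
have [->|pj] := eqVneq (p 0 j) 0.
  by rewrite mul0r subr0 add0r => qj; have := q0 j; rewrite qj ltxx.
have pj0 : 0 < p 0 j by rewrite lt_neqAle eq_sym pj p0.
have y0 : 0 < q j / p 0 j by rewrite divr_gt0.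
rewrite -[p 0 j / q j]invf_div lnV ?posrE // => eq0.
have [y1|/(ln_lt_subr1 y0)] := eqVneq (q j / p 0 j) 1.
  by have := divfK pj (q j); rewrite y1 mul1r.
rewrite -(ltr_pM2l pj0) mulrBr mulr1 mulrCA divff // mulr1; lra.
Qed.

End MirrorStep.

(** * Regret of one block *)

Section Regret.
Context {R : realType} {J : finType}.
Context (eta B : R) (T : nat) (l x g : nat -> J -> R).

(** The potential [sum_j s j ln (g j)] changes by [- eta <l1, s> - ln Z], where Z
    normalizes the second tilt.  Writing Z through the intermediate point p, as a
    quotient of moment generating functions of [l1 - l0] and of [l0] under p,
    makes both variances appear. *)
Lemma omd_step (s p q : J -> R) (l0 l1 g0 : J -> R) :
  0 < eta -> 12 * (eta * B) <= 1 -> distr g0 ->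
  (forall j, `|l0 j| <= B) -> (forall j, `|l1 j| <= B) ->
  \sum_j s j = 1 ->
  p =1 tilt g0 (fun j => - (eta * l0 j)) -> q =1 tilt g0 (fun j => - (eta * l1 j)) ->
  eta * \sum_j l1 j * (p j - s j) <=
  \sum_j s j * ln (q j) - \sum_j s j * ln (g0 j) +
  eta ^+ 2 * (fvariance p (fun j => l1 j - l0 j) - fvariance p l0 / 5).
Proof.
move=> eta0 etaB dg l0B l1B s1 pE qE.
have dp : distr p.
  have [t0 t1] := tilt_distr (fun j => - (eta * l0 j)) dg.
  by split=> [j|]; [rewrite pE|rewrite (eq_bigr _ (fun j _ => pE j))].
set Z := \sum_j g0 j * expR (- (eta * l1 j)).
set Y := \sum_j g0 j * expR (- (eta * l0 j)).
have Z0 : 0 < Z := tilt_sum_gt0 _ dg.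
have Y0 : 0 < Y := tilt_sum_gt0 _ dg.
have small (u : J -> R) (c : R) : (forall j, `|u j| <= c * B) -> c <= 2 ->
    forall j, `|eta * u j| <= 1 / 6.
  move=> uB c2 j; rewrite normrM gtr0_norm //.
  have B0 : 0 <= B := le_trans (normr_ge0 _) (l0B j).
  apply: (@le_trans _ _ (eta * (c * B))); first
    by apply: ler_wpM2l; [exact/ltW|exact: uB].
  have : c * (eta * B) <= 2 * (eta * B).
    by apply: ler_wpM2r => //; apply: mulr_ge0 => //; exact/ltW.
  by rewrite mulrCA; lra.
have pot : \sum_j s j * ln (q j) - \sum_j s j * ln (g0 j) =
    - (eta * \sum_j l1 j * s j) - ln Z.
  rewrite -sumrB -[ln Z]mul1r -s1 mulr_suml mulr_sumr -sumrN -sumrB.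
  apply: eq_bigr => j _; rewrite qE /tilt -/Z.
  have gj := dg.1 j.
  rewrite ln_div ?posrE ?mulr_gt0 ?expR_gt0 // lnM ?posrE ?expR_gt0 // expRK; ring.
have mgf1 : \sum_j p j * expR (- (eta * (l1 j - l0 j))) = Z / Y.
  rewrite mulr_suml; apply: eq_bigr => j _; rewrite pE /tilt -/Y.
  have -> : - (eta * l1 j) = - (eta * l0 j) + - (eta * (l1 j - l0 j)) by ring.
  by rewrite expRD; ring.
have mgf0 : \sum_j p j * expR (eta * l0 j) = Y^-1.
  rewrite -[RHS]mul1r -[1]dg.2 mulr_suml; apply: eq_bigr => j _.
  rewrite pE /tilt -/Y expRN; field.
  by rewrite !gt_eqF ?expR_gt0.
have /andP[_ up] : fvariance p (fun j => - (eta * (l1 j - l0 j))) / 5 <=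
    ln (\sum_j p j * expR (- (eta * (l1 j - l0 j)))) -
    \sum_j p j * - (eta * (l1 j - l0 j)) <=
    fvariance p (fun j => - (eta * (l1 j - l0 j))).
  apply: ln_mgf => // j; rewrite normrN.
  apply: (small (fun j => l1 j - l0 j) 2) => // i.
  by apply: le_trans (ler_normB _ _) _; have := l0B i; have := l1B i; lra.
have /andP[lo _] : fvariance p (fun j => eta * l0 j) / 5 <=
    ln (\sum_j p j * expR (eta * l0 j)) - \sum_j p j * (eta * l0 j) <=
    fvariance p (fun j => eta * l0 j).
  apply: ln_mgf => // j; apply: (small l0 1) => [i|]; [by rewrite mul1r|lra].
rewrite mgf1 fvarianceN fvarianceZ ln_div ?posrE // in up.
rewrite mgf0 fvarianceZ lnV ?posrE // in lo.
have e1 : \sum_j p j * - (eta * (l1 j - l0 j)) =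
    eta * \sum_j p j * l0 j - eta * \sum_j l1 j * p j.
  by rewrite !mulr_sumr -sumrB; apply: eq_bigr => j _; ring.
have e0 : \sum_j p j * (eta * l0 j) = eta * \sum_j p j * l0 j.
  by rewrite mulr_sumr; apply: eq_bigr => j _; ring.
have e2 : \sum_j l1 j * (p j - s j) = \sum_j l1 j * p j - \sum_j l1 j * s j.
  by rewrite -sumrB; apply: eq_bigr => j _; ring.
rewrite e1 in up; rewrite e0 in lo; rewrite pot e2 !mulrBr.
lra.
Qed.

(** The potential starts at [- ln n] for the uniform distribution and is never
    positive. *)
Lemma omd_regret (s : J -> R) :
  0 < eta -> 12 * (eta * B) <= 1 ->
  (forall t j, (t <= T)%N -> `|l t j| <= B) ->
  (forall j, g 0%N j = #|J|%:R^-1) ->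
  (forall t, (t < T)%N -> x t.+1 =1 tilt (g t) (fun j => - (eta * l t j))) ->
  (forall t, (t < T)%N -> g t.+1 =1 tilt (g t) (fun j => - (eta * l t.+1 j))) ->
  (forall t, (t <= T)%N -> distr (g t)) ->
  (forall j, 0 <= s j) -> \sum_j s j = 1 ->
  eta * \sum_(0 <= t < T) \sum_j l t.+1 j * (x t.+1 j - s j) <=
  ln #|J|%:R + eta ^+ 2 * \sum_(0 <= t < T)
    (fvariance (x t.+1) (fun j => l t.+1 j - l t j) - fvariance (x t.+1) (l t) / 5).
Proof.
move=> eta0 etaB lB g0 xE gE dg s0 s1.
pose Phi t := \sum_j s j * ln (g t j).
have PhiT : Phi T <= 0.
  apply: sumr_le0 => j _; rewrite mulr_ge0_le0 // ln_le0 //.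
  have [gp gs] := dg T (leqnn T); rewrite -gs (bigD1 j) //= lerDl.
  by apply: sumr_ge0 => i _; exact/ltW.
have Phi0 : Phi 0%N = - ln #|J|%:R.
  rewrite /Phi (eq_bigr (fun j => s j * - ln #|J|%:R)) => [|j _].
    by rewrite -mulr_suml s1 mul1r.
  by rewrite g0 lnV // posrE ltr0n; apply/card_gt0P; exists j.
have step n : (n <= T)%N ->
    eta * \sum_(0 <= t < n) \sum_j l t.+1 j * (x t.+1 j - s j) <=
    Phi n - Phi 0%N + eta ^+ 2 * \sum_(0 <= t < n)
    (fvariance (x t.+1) (fun j => l t.+1 j - l t j) - fvariance (x t.+1) (l t) / 5).
  elim: n => [|n IH] nT; first by rewrite !big_geq // !mulr0 subrr addr0.
  rewrite !big_nat_recr //= !(mulrDr _ _ (\sum_j _)) [eta ^+ 2 * (_ + _)]mulrDr.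
  have := IH (ltnW nT).
  have := @omd_step s (x n.+1) (g n.+1) (l n) (l n.+1) (g n) eta0 etaB
    (dg n (ltnW nT)) (fun j => lB n j (ltnW nT)) (fun j => lB n.+1 j nT) s1
    (xE n nT) (gE n nT).
  rewrite -/(Phi _) -/(Phi _); lra.
have := step T (leqnn T); rewrite Phi0; lra.
Qed.

End Regret.

(** * Interpolation between orders of differences *)

Section Interpolation.
Context {R : realType}.

(** The discrete form of integrating [w u'^2] by parts into [- (w u')' u]. *)
Lemma summation_by_parts (w u v z : nat -> R) n :
  (forall s, v s = u s.+1 - u s) -> (forall s, z s = v s.+1 - v s) ->
  \sum_(0 <= s < n.+1) w s * v s ^+ 2 =
  w n * v n * u n.+1 - w 0%N * v 0%N * u 0%N
  + \sum_(0 <= s < n) ((w s - w s.+1) * v s.+1 * u s.+1 - w s * z s * u s.+1).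
Proof.
move=> vE zE; elim: n => [|n IH].
  by rewrite big_nat1 big_geq // !vE; ring.
by rewrite big_nat_recr // IH [in RHS]big_nat_recr //= zE !vE; ring.
Qed.

(** The two terms of the summation by parts are split by the inequality of
    arithmetic and geometric means, the first one with a free parameter c. *)
Lemma interpolation_scalar (w u v z : nat -> R) (c eps : R) n :
  (forall s, v s = u s.+1 - u s) -> (forall s, z s = v s.+1 - v s) ->
  0 < c -> 0 <= eps ->
  (forall s, (s <= n)%N -> 0 <= w s) -> 0 <= w n.+1 ->
  (forall s, (s < n)%N -> `|w s - w s.+1| <= eps * w s.+1) ->
  \sum_(0 <= s < n.+1) w s * v s ^+ 2 <=
  w n * v n * u n.+1 - w 0%N * v 0%N * u 0%N
  + (2 * c)^-1 * (\sum_(0 <= s < n) w s * z s ^+ 2)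
  + (c * (1 + eps) / 2 + eps / 2) * (\sum_(0 <= s < n.+2) w s * u s ^+ 2)
  + eps / 2 * (\sum_(0 <= s < n.+1) w s * v s ^+ 2).
Proof.
move=> vE zE c0 e0 w0 wn1 weps; rewrite {1}(summation_by_parts w n vE zE) -!addrA.
do 2!apply: lerD => //.
have shift (a : nat -> R) : (forall s, (s <= n.+1)%N -> 0 <= a s) ->
    \sum_(0 <= s < n) a s.+1 <= \sum_(0 <= s < n.+1) a s.
  by move=> a0; rewrite [leRHS]big_nat_recl //= lerDr a0.
have w0' s : (s <= n.+1)%N -> 0 <= w s.
  by rewrite leq_eqVlt => /orP[/eqP->|/w0].
have sq0 (a : nat -> R) s : (s <= n.+1)%N -> 0 <= w s * a s ^+ 2.
  by move=> sn; apply: mulr_ge0; [exact: w0'|exact: sqr_ge0].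
have hu : \sum_(0 <= s < n) w s.+1 * u s.+1 ^+ 2 <= \sum_(0 <= s < n.+2) w s * u s ^+ 2.
  apply: (le_trans (shift (fun s => w s * u s ^+ 2) (sq0 u))).
  by rewrite [leRHS]big_nat_recr //= lerDl sq0.
have hv : \sum_(0 <= s < n) w s.+1 * v s.+1 ^+ 2 <= \sum_(0 <= s < n.+1) w s * v s ^+ 2.
  exact: (shift (fun s => w s * v s ^+ 2) (sq0 v)).
apply: (@le_trans _ _ ((2 * c)^-1 * (\sum_(0 <= s < n) w s * z s ^+ 2)
  + ((c * (1 + eps) / 2 + eps / 2) * (\sum_(0 <= s < n) w s.+1 * u s.+1 ^+ 2)
  + eps / 2 * (\sum_(0 <= s < n) w s.+1 * v s.+1 ^+ 2)))); last first.
  have k1 : 0 <= c * (1 + eps) / 2 + eps / 2.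
    by apply: addr_ge0; apply: divr_ge0 => //; apply: mulr_ge0; lra.
  have k2 : 0 <= eps / 2 by lra.
  by rewrite lerD2l; apply: lerD; apply: ler_wpM2l.
rewrite !mulr_sumr -!big_split /=; apply: ler_sum_nat => s /andP[_ sn].
have ws0 : 0 <= w s by apply: w0; exact: ltnW.
have ws1 : 0 <= w s.+1 by apply: w0'; rewrite ltnS ltnW.
have wu : w s - w s.+1 <= eps * w s.+1 := le_trans (ler_norm _) (weps s sn).
have z1 : - (w s * z s * u s.+1) <=
    w s * ((2 * c)^-1 * z s ^+ 2 + c / 2 * u s.+1 ^+ 2).
  rewrite -mulrA -mulrN ler_wpM2l // -subr_ge0.
  have -> : (2 * c)^-1 * z s ^+ 2 + c / 2 * u s.+1 ^+ 2 - - (z s * u s.+1) =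
      (2 * c)^-1 * (z s + c * u s.+1) ^+ 2 by field; rewrite gt_eqF.
  by apply: mulr_ge0; [rewrite invr_ge0; lra|exact: sqr_ge0].
have z2 : w s * (c / 2 * u s.+1 ^+ 2) <=
    (1 + eps) * w s.+1 * (c / 2 * u s.+1 ^+ 2).
  apply: ler_wpM2r; last lra.
  by apply: mulr_ge0; [lra|exact: sqr_ge0].
have z3 : (w s - w s.+1) * v s.+1 * u s.+1 <=
    eps * w s.+1 * ((v s.+1 ^+ 2 + u s.+1 ^+ 2) / 2).
  apply: le_trans (ler_norm _) _; rewrite -mulrA normrM.
  apply: ler_pM; [exact: normr_ge0|exact: normr_ge0|exact: weps|].
  rewrite ler_norml; apply/andP; split.
    by have := sqr_ge0 (v s.+1 + u s.+1); nra.
  by have := sqr_ge0 (v s.+1 - u s.+1); nra.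
apply: (@le_trans _ _ (eps * w s.+1 * ((v s.+1 ^+ 2 + u s.+1 ^+ 2) / 2) +
  (w s * ((2 * c)^-1 * z s ^+ 2) + (1 + eps) * w s.+1 * (c / 2 * u s.+1 ^+ 2)))).
  apply: lerD; first exact: z3.
  by apply: le_trans z1 _; rewrite mulrDr lerD2l.
rewrite le_eqVlt; apply/orP; left; apply/eqP; field; exact/lt0r_neq0.
Qed.

Context {I : finType}.
Implicit Types (w u : nat -> I -> R) (m h n s : nat).

(** The range shrinks by one at each order, so that the summation by parts of order
    h + 1 only reads terms that belong to order h. *)
Definition energy w u m h := \sum_(0 <= s < m - h)
  \sum_i w s i * iter h fdiff (fun t => u t i) s ^+ 2.

Lemma energy_ge0 w u m h : (forall s i, 0 <= w s i) -> 0 <= energy w u m h.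
Proof.
move=> w0; apply: sumr_ge0 => s _; apply: sumr_ge0 => i _.
by apply: mulr_ge0 => //; exact: sqr_ge0.
Qed.

Lemma energy_step w u m h (c eps b0 b1 : R) :
  0 < c -> 0 <= eps -> 0 <= b0 -> 0 <= b1 ->
  (forall s i, 0 <= w s i) ->
  (forall s, \sum_i w s i <= 1) ->
  (forall s i, (s.+1 < m)%N -> `|w s i - w s.+1 i| <= eps * w s.+1 i) ->
  (forall s i, (s + h < m)%N -> `|iter h fdiff (fun t => u t i) s| <= b0) ->
  (forall s i, (s + h.+1 < m)%N -> `|iter h.+1 fdiff (fun t => u t i) s| <= b1) ->
  energy w u m h.+1 <= 2 * (b0 * b1) + (2 * c)^-1 * energy w u m h.+2
    + (c * (1 + eps) / 2 + eps / 2) * energy w u m h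
    + eps / 2 * energy w u m h.+1.
Proof.
move=> c0 e0 b00 b10 w0 w1 weps ub0 ub1.
case En : (m - h.+1)%N => [|n].
  rewrite {1}/energy En big_geq //.
  have ek k := energy_ge0 u m k w0.
  rewrite !addr_ge0 // !mulr_ge0 // ?invr_ge0 ?addr_ge0 ?divr_ge0 ?mulr_ge0 //; lra.
have Eh2 : (m - h.+2 = n)%N by lia.
have Eh : (m - h = n.+2)%N by lia.
rewrite /energy En Eh Eh2 ![\sum_(0 <= s < _) _]exchange_big /=.
have bdry s s' i : (s + h.+1 < m)%N -> (s' + h < m)%N ->
    `|w s i * iter h.+1 fdiff (fun t => u t i) s * iter h fdiff (fun t => u t i) s'|
    <= w s i * (b1 * b0).
  move=> sm s'm; rewrite -mulrA normrM ger0_norm // ler_wpM2l // normrM.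
  by apply: ler_pM => //; [exact: ub1|exact: ub0].
apply: (@le_trans _ _ (\sum_i ((w n i * (b1 * b0) + w 0%N i * (b1 * b0))
  + (2 * c)^-1 * (\sum_(0 <= s < n) w s i * iter h.+2 fdiff (fun t => u t i) s ^+ 2)
  + (c * (1 + eps) / 2 + eps / 2) *
      (\sum_(0 <= s < n.+2) w s i * iter h fdiff (fun t => u t i) s ^+ 2)
  + eps / 2 *
      (\sum_(0 <= s < n.+1) w s i * iter h.+1 fdiff (fun t => u t i) s ^+ 2)))).
  apply: ler_sum => i _.
  apply: le_trans (@interpolation_scalar (w^~ i)
    (iter h fdiff (fun t => u t i)) _ _ c eps n (fun=> erefl) (fun=> erefl) c0 e0
    _ _ _) _ => // [s sn|]; first by apply: weps; lia.
  rewrite !lerD2r; apply: lerD.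
    by apply: le_trans (ler_norm _) (bdry _ _ _ _ _); lia.
  by apply: le_trans (ler_norm _) _; rewrite normrN; apply: bdry; lia.
rewrite !big_split /= -!mulr_sumr !lerD2r -!mulr_suml.
have := w1 n; have := w1 0%N; have : 0 <= b0 * b1 by apply: mulr_ge0.
by rewrite mulrC [b1 * b0]mulrC; nra.
Qed.

(** Downward induction on the order with the ratio itself as parameter c of the
    interpolation: the ratio grows by [d = 1 / (16 H)] at each of the H steps, which
    absorbs the variation eps of the weights, and does not exceed 1/8. *)
Lemma energy_contraction w u m H (M eps : R) :
  0 <= eps -> 48 * eps * H%:R <= 1 -> (m <= 4 ^ H)%N -> 0 <= M ->
  (forall s i, 0 <= w s i) ->
  (forall s, \sum_i w s i <= 1) ->
  (forall s i, (s.+1 < m)%N -> `|w s i - w s.+1 i| <= eps * w s.+1 i) ->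
  (forall h s i, (h <= H)%N -> (s + h < m)%N ->
     `|iter h fdiff (fun t => u t i) s| <= M * 32^-1 ^+ h) ->
  (0 < H)%N ->
  energy w u m 1 <= 8^-1 * energy w u m 0 + 16 * M ^+ 2.
Proof.
move=> e0 eH mH M0 w0 w1 weps uM H0.
have H0' : 0 < H%:R :> R by rewrite ltr0n.
pose d : R := (16 * H%:R)^-1.
have dH : d * H%:R = 16^-1 by rewrite /d; field; rewrite gt_eqF.
have d0 : 0 < d by rewrite /d invr_gt0; lra.
have ed : 3 * eps <= d.
  by rewrite /d -div1r ler_pdivlMr; lra.
have e48 : eps <= 1 / 48.
  have : 1 <= H%:R :> R by rewrite ler1n.
  nra.
have claim k h : (h + k.+1 = H)%N -> energy w u m h.+1 <=
    (16^-1 + k%:R * d) * energy w u m h + 16 * M ^+ 2 * 64^-1 ^+ h.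
  elim: k h => [|k IH] h hk.
    rewrite mul0r addr0 -[leLHS]add0r; apply: lerD.
      by apply: mulr_ge0; [lra|exact: energy_ge0].
    have hH : h.+1 = H by lia.
    have [E EE E0] : exists2 E, E = (M * 32^-1 ^+ H) ^+ 2 & 0 <= E.
      by exists ((M * 32^-1 ^+ H) ^+ 2); rewrite ?sqr_ge0.
    (* At the top order the energy is bounded by its number of terms, at most
       [4 ^ H], against [32 ^ (- 2 H)]. *)
    have AE : energy w u m H <= m%:R * E.
      apply: (@le_trans _ _ (\sum_(0 <= s < m - H) E)); last first.
        rewrite big_const_nat subn0 iter_addr_0 -[E *+ _]mulr_natl.
        by apply: ler_wpM2r => //; rewrite ler_nat leq_subr.
      apply: ler_sum_nat => s /andP[_ sm].
      rewrite -[leRHS]mul1r; apply: (@le_trans _ _ (\sum_i w s i * E)).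
        apply: ler_sum => i _; apply: ler_wpM2l => //.
        rewrite EE -[_ ^+ 2 in leLHS]ger0_norm ?sqr_ge0 // normrX.
        apply: lerXn2r; rewrite ?nnegrE.
        - exact: normr_ge0.
        - by apply: mulr_ge0 => //; apply: exprn_ge0; lra.
        - by apply: uM => //; lia.
      by rewrite -mulr_suml; apply: ler_wpM2r => //; exact: w1.
    rewrite hH; apply: le_trans AE _.
    apply: (@le_trans _ _ (4 ^+ H * E)).
      by apply: ler_wpM2r => //; rewrite -natrX ler_nat.
    have q0 : 0 <= (4 * (32^-1 * 32^-1) : R) by lra.
    have -> : 4 ^+ H * E = M ^+ 2 * (4 * (32^-1 * 32^-1)) ^+ H.
      by rewrite EE !exprMn; ring.
    have qh : (4 * (32^-1 * 32^-1) : R) ^+ h <= 64^-1 ^+ h.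
      by apply: lerXn2r; rewrite ?nnegrE; lra.
    have qh0 : 0 <= (4 * (32^-1 * 32^-1) : R) ^+ h by exact: exprn_ge0.
    rewrite -[in leLHS]hH.
    have -> : 16 * M ^+ 2 * 64^-1 ^+ h = M ^+ 2 * (16 * 64^-1 ^+ h) by ring.
    apply: ler_wpM2l; first exact: sqr_ge0.
    rewrite exprS; move: qh qh0; set a := (_ ^+ h); set b := 64^-1 ^+ h; lra.
  have {}IH := IH h.+1 ltac:(lia).
  set r0 := 16^-1 + k%:R * d in IH.
  have kH : k%:R <= H%:R :> R by rewrite ler_nat; lia.
  have r0l : 16^-1 <= r0 by rewrite /r0 lerDl mulr_ge0 // ltW.
  have r0u : r0 <= 8^-1.
    have : k%:R * d <= 16^-1 by rewrite -dH mulrC ler_wpM2l // ltW.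
    by rewrite /r0; lra.
  have -> : 16^-1 + k.+1%:R * d = r0 + d by rewrite /r0 -natr1; ring.
  have q0 j : 0 <= (32^-1 : R) ^+ j by apply: exprn_ge0; lra.
  have := @energy_step w u m h r0 eps (M * 32^-1 ^+ h) (M * 32^-1 ^+ h.+1)
    ltac:(lra) e0 (mulr_ge0 M0 (q0 _)) (mulr_ge0 M0 (q0 _)) w0 w1 weps
    (fun s i sh => uM h s i ltac:(lia) sh) (fun s i sh => uM h.+1 s i ltac:(lia) sh).
  have A0 := energy_ge0 u m h w0; have A1 := energy_ge0 u m h.+1 w0.
  set a0 := energy _ _ _ h in A0 *; set a1 := energy _ _ _ h.+1 in A1 IH *.
  set a2 := energy _ _ _ h.+2 in IH *.
  have bq : M * 32^-1 ^+ h * (M * 32^-1 ^+ h.+1) <= M ^+ 2 * 64^-1 ^+ h.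
    have -> : M * 32^-1 ^+ h * (M * 32^-1 ^+ h.+1) =
        M ^+ 2 * (32^-1 * (32^-1 ^+ h * 32^-1 ^+ h)) by rewrite exprS; ring.
    apply: ler_wpM2l; first exact: sqr_ge0.
    rewrite -exprMn.
    have : (32^-1 * 32^-1 : R) ^+ h <= 64^-1 ^+ h.
      by apply: lerXn2r; rewrite ?nnegrE; lra.
    have : 0 <= (32^-1 * 32^-1 : R) ^+ h by apply: exprn_ge0; lra.
    lra.
  rewrite (exprS 64^-1) in IH.
  set K := 64^-1 ^+ h in bq IH *.
  have K0 : 0 <= M ^+ 2 * K.
    by apply: mulr_ge0; [exact: sqr_ge0|apply: exprn_ge0; lra].
  have a2r : (2 * r0)^-1 * a2 <= 2^-1 * a1 + 2 * (M ^+ 2 * K).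
    have -> : (2 * r0)^-1 * a2 = a2 / (2 * r0) by rewrite mulrC.
    rewrite ler_pdivrMr; last lra.
    apply: le_trans IH _.
    have : 0 <= (r0 - 16^-1) * (M ^+ 2 * K) by apply: mulr_ge0 => //; lra.
    by lra.
  move=> step.
  set P := M ^+ 2 * K in bq K0 a2r *.
  have key : a1 * (1 - eps) <= 8 * P + (r0 + 2 * eps) * a0.
    have : 0 <= (1 - r0) * (eps * a0).
      by apply: mulr_ge0; [lra|exact: mulr_ge0].
    lra.
  have d16 : d <= 16^-1.
    by rewrite -dH ler_peMr ?ler1n // ltW.
  have e1 : 0 <= ((r0 + d) * (1 - eps) - (r0 + 2 * eps)) * a0.
    apply: mulr_ge0 => //.
    have : 0 <= eps * (1 - r0 - d) by apply: mulr_ge0; lra.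
    lra.
  have e2 : 0 <= P * (1 - 2 * eps) by apply: mulr_ge0; lra.
  have -> : 16 * M ^+ 2 * K = 16 * P by rewrite /P mulrA.
  suff : a1 * (1 - eps) <= ((r0 + d) * a0 + 16 * P) * (1 - eps).
    by rewrite ler_pM2r //; lra.
  lra.
have := claim H.-1 0%N ltac:(lia); rewrite expr0 mulr1.
have A0 := energy_ge0 u m 0 w0 => h1; apply: le_trans h1 _; rewrite lerD2r.
rewrite ler_wpM2r //.
have : H.-1%:R * d <= 16^-1.
  by rewrite -dH mulrC ler_wpM2l ?ler_nat ?leq_pred // ltW.
lra.
Qed.

End Interpolation.

(** * Taylor majorants on windows *)

Section TaylorMajorant.
Context {R : realType}.

Lemma row_entry_le_norm (m : nat) (v : 'rV[R]_m) j : `|v 0 j| <= `|v|.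
Proof.
rewrite [leRHS]/Num.norm /= mx_normrE.
exact: (le_bigmax 0 (fun ij : 'I_1 * 'I_m => `|v ij.1 ij.2|) (0, j)).
Qed.

Context {m : nat}.
Implicit Types (phi : 'rV[R]_m -> R) (x y : 'rV[R]_m) (z : nat -> 'rV[R]_m).

(** Every monomial is bounded by the product of the norms of its factors, so the
    whole polynomial is bounded by its majorant [taylor_P] at a point A times
    larger, at the cost of A per degree. *)
Lemma wnorm_taylor_poly (r A : R) h K phi y x z :
  0 <= r -> 1 <= A ->
  (forall j, wnorm r h (fun s => z s 0 j) <= A * `|x 0 j|) ->
  wnorm r h (fun s => phi (z s) - taylor_R phi K y (z s)) <=
  A ^+ K * taylor_P phi K y x.
Proof.
move=> r0 A1 zA; have A0 : 0 <= A by lra.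
have zyA j : wnorm r h (fun s => (z s - y) 0 j) <= A * (`|x 0 j| + `|y 0 j|).
  rewrite (eq_wnorm r (v := fun s => z s 0 j + - y 0 j)) => [|s _]; last first.
    by rewrite !mxE.
  apply: le_trans (wnormD r0 _ _ _) _; rewrite mulrDr; apply: lerD => //.
  apply: le_trans (wnorm_cst r0 _ _) _; rewrite normrN.
  by rewrite ler_peMl.
rewrite (eq_wnorm r (v := fun s => \sum_(0 <= i < K.+1)
    \sum_(alpha : {ffun 'I_m -> 'I_i.+1} | (\sum_j alpha j == i)%N)
    mderive (fun j => alpha j : nat) phi y / (mfact (fun j => alpha j : nat))%:R *
    mpow (z s - y) (fun j => alpha j : nat))); last first.
  by move=> s _; rewrite /taylor_R subKr.
apply: le_trans (wnorm_sum r0 _ _ _ _) _; rewrite /taylor_P mulr_sumr.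
apply: ler_sum_nat => i /andP[_ iK].
apply: le_trans (wnorm_sum r0 _ _ _ _) _; rewrite mulr_sumr.
apply: ler_sum => alpha /eqP ai.
apply: le_trans (wnormZ r0 _ _ _) _.
rewrite normrM normfV normr_nat mulrCA.
apply: ler_wpM2l; first by apply: divr_ge0.
apply: le_trans (wnorm_prod r0 _ _ _) _.
apply: (@le_trans _ _ (\prod_j (A * (`|x 0 j| + `|y 0 j|)) ^+ alpha j)).
  apply: ler_prod => j _; rewrite wnorm_ge0 //=.
  apply: le_trans (wnormX r0 _ _ _) _.
  by apply: lerXn2r; rewrite ?nnegrE ?wnorm_ge0 ?mulr_ge0 ?addr_ge0.
under eq_bigr => j _ do rewrite exprMn.
rewrite big_split /= prodrXr ai.
have -> : \prod_j (`|x 0 j| + `|y 0 j|) ^+ alpha j =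
    mpow (map_mx Num.norm x + map_mx Num.norm y) (fun j => alpha j : nat).
  by apply: eq_bigr => j _; rewrite !mxE.
apply: ler_wpM2r; last by apply: ler_weXn2l.
by apply: prodr_ge0 => j _; rewrite !mxE exprn_ge0 // addr_ge0.
Qed.

(** The previous bound for a constant sequence, on a window reduced to a point. *)
Lemma taylor_poly_le phi K y x :
  `|phi x - taylor_R phi K y x| <= taylor_P phi K y x.
Proof.
have := @wnorm_taylor_poly 0 1 0 K phi y x (fun=> x) (lexx _) (lexx _).
rewrite expr1n mul1r => /(_ _)/(le_trans _); apply.
  have := @fdiff_le_wnorm R 0 (lexx _) 0
    (fun=> phi x - taylor_R phi K y x) 0 0 (leqnn _).
  by rewrite expr0 fact0 divr1 mul1r /=.
by move=> j; rewrite mul1r; exact: wnorm_cst.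
Qed.

Lemma taylor_P_ge0 phi K y x : 0 <= taylor_P phi K y x.
Proof.
apply: sumr_ge0 => i _; apply: sumr_ge0 => al _.
apply: mulr_ge0; first by apply: divr_ge0.
by apply: prodr_ge0 => j _; rewrite !mxE exprn_ge0 // addr_ge0.
Qed.

(** The factor [(1 - 2 a)^-1] is the one of [wnorm_tilt]; as a is of order 1 / K, its
    K-th power stays below 2.  The remainder e0 has to survive H differences in
    the norm of parameter r, whence the decay required of it. *)
Lemma wnorm_comp_analytic (r a e0 Theta2 : R) (K H h : nat) phi y z :
  0 <= r -> 0 <= a -> (0 < K)%N -> 4 * a * K%:R <= 1 -> (h <= H)%N ->
  (forall j, wnorm r h (fun s => z s 0 j) <= (1 - 2 * a)^-1 * `|z 0%N 0 j|) ->
  0 <= e0 -> (forall k, (k <= H)%N -> e0 * (2 * r) ^+ k <= 2^-1 ^+ k) ->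
  (forall s, (s <= h)%N -> `|taylor_R phi K y (z s)| <= e0) ->
  taylor_P phi K y (z 0%N) <= Theta2 ->
  wnorm r h (fun s => phi (z s)) <= 2 * Theta2 + 2.
Proof.
move=> r0 a0 K0 aK hH za e00 e0r phiR phiP.
have K1 : 1 <= K%:R :> R by rewrite ler1n.
have a4 : a <= 1 / 4 by nra.
set A := (1 - 2 * a)^-1 in za.
have A1 : 1 <= A by rewrite /A -div1r ler_pdivlMr; lra.
have bern k : 1 - 2 * a * k%:R <= (1 - 2 * a) ^+ k.
  elim: k => [|k IH]; first by rewrite mulr0 subr0.
  rewrite exprS; apply: (@le_trans _ _ ((1 - 2 * a) * (1 - 2 * a * k%:R))).
    by have : 0 <= k%:R :> R by []; rewrite -natr1; nra.
  by apply: ler_wpM2l => //; lra.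
have AK : A ^+ K <= 2.
  rewrite /A exprVn -div1r ler_pdivrMr; last by apply: exprn_gt0; lra.
  by have := bern K; nra.
rewrite (eq_wnorm r (v := fun s => (phi (z s) - taylor_R phi K y (z s)) +
    taylor_R phi K y (z s))) => [|s _]; last by rewrite subrK.
apply: le_trans (wnormD r0 _ _ _) _; apply: lerD.
  apply: le_trans (wnorm_taylor_poly K phi y r0 A1 za) _.
  apply: ler_pM => //; first by apply: exprn_ge0; lra.
  exact: taylor_P_ge0.
apply: le_trans (wnorm_sup r0 e00 phiR) _.
have geo k : \sum_(0 <= i < k) 2^-1 ^+ i <= 2 - 2^-1 ^+ k * 2 :> R.
  elim: k => [|k IH]; first by rewrite big_geq // expr0; lra.
  by rewrite big_nat_recr //= exprS; lra.
apply: (@le_trans _ _ (\sum_(0 <= k < h.+1) 2^-1 ^+ k)).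
  rewrite mulr_sumr; apply: ler_sum_nat => k /andP[_ kh].
  rewrite mulrA; apply: le_trans (_ : _ <= e0 * (2 * r) ^+ k) _; last first.
    by apply: e0r; lia.
  apply: ler_piMr; first by rewrite mulr_ge0 ?exprn_ge0 ?mulr_ge0.
  by rewrite invf_le1 ?ltr0n ?fact_gt0 // ler1n fact_gt0.
apply: le_trans (geo _) _; rewrite gerBl mulr_ge0 ?exprn_ge0 //; lra.
Qed.

End TaylorMajorant.

(** * High-order smoothness of the iterates *)

Section HighOrderSmoothness.
Context {R : realType}.

(** On a window the iterate is a single tilt of its first value, with a discrete
    primitive as exponent, to which [wnorm_tilt] and [wnorm_primitive] apply. *)
Lemma tilt_iter (J : finType) (X V : nat -> J -> R) h :
  distr (X 0%N) -> (forall s, (s < h)%N -> X s.+1 =1 tilt (X s) (V s)) ->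
  forall s, (s <= h)%N -> X s =1 tilt (X 0%N) (fun j => \sum_(0 <= i < s) V i j).
Proof.
move=> d0 XV; elim=> [|s IH] sh j.
  rewrite -[LHS](tilt0 d0); apply: eq_tilt => // k; by rewrite big_geq.
rewrite XV // (eq_tilt (IH (ltnW sh)) (frefl _)) tilt_tilt //.
by apply: eq_tilt => // k; rewrite big_nat_recr.
Qed.

Context {d : nat} {n : 'I_d -> nat}.
Local Notation point := 'rV[R]_(\sum_i n i).

Lemma submxrowE (x : point) i j : submxrow x i 0 j = x 0 (tagnat.Rank i j).
Proof. by rewrite mxE. Qed.

(** Induction on the order h.  On the window starting at t0, the iterate is the tilt
    of [x t0] by the primitive of V, and the differences of V up to order h are
    controlled by those of F along x on the windows starting at t0 and t0 - 1.
    The latter is why t0 has to grow with h: the recursion reads one step further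
    into the past at each order, and it does not hold at time 0. *)
Lemma finite_difference_bound (F : point -> point) (x : nat -> point)
    (r eta M B a : R) (H T : nat) :
  0 <= r -> 0 < eta -> a < 1 / 2 -> 0 <= B -> B <= M ->
  3 * eta * (H%:R * B) + 3 * eta * (r * M) <= a ->
  (forall z h k, (h <= H)%N -> (forall s, (s <= h)%N -> simplices (z s)) ->
     (forall j, wnorm r h (fun s => z s 0 j) <= (1 - 2 * a)^-1 * `|z 0%N 0 j|) ->
     wnorm r h (fun s => F (z s) 0 k) <= M) ->
  (forall t i, (t <= T)%N -> distr (submxrow (x t) i 0)) ->
  (forall t k, (t <= T)%N -> `|F (x t) 0 k| <= B) ->
  (forall t i, (t.+2 <= T)%N -> submxrow (x t.+2) i 0 =1
     tilt (submxrow (x t.+1) i 0) (fun j =>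
       eta * (submxrow (F (x t)) i 0 j - 2 * submxrow (F (x t.+1)) i 0 j))) ->
  forall h t0 k, (h <= H)%N -> (h <= t0)%N -> (t0 + h <= T)%N ->
  wnorm r h (fun s => F (x (t0 + s)%N) 0 k) <= M.
Proof.
move=> r0 eta0 a12 B0 BM etaa HF dx FB dyn; elim=> [|h IH] t0 k hH ht tT.
  apply: le_trans (wnorm_sup r0 B0 _) _ => [s|].
    by rewrite leqn0 => /eqP->; apply: FB; lia.
  by rewrite big_nat1 expr0 fact0 divr1 mulr1.
case: t0 ht tT => [//|t1] ht tT.
have sx t : (t <= T)%N -> simplices (x t).
  by move=> tle i; have [p0 p1] := dx t i tle; split=> // j; exact/ltW.
apply: HF => // [s sh|k']; first by apply: sx; lia.
rewrite -(tagnat.sig2K k'); set i := tagnat.sig1 k'; set j := tagnat.sig2 k'.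
pose V s (j : 'I_(n i)) := eta *
  (submxrow (F (x (t1 + s)%N)) i 0 j - 2 * submxrow (F (x (t1.+1 + s)%N)) i 0 j).
have d0 : distr (submxrow (x (t1.+1 + 0)%N) i 0) by apply: dx; lia.
have XV s : (s < h.+1)%N -> submxrow (x (t1.+1 + s.+1)%N) i 0 =1
    tilt (submxrow (x (t1.+1 + s)%N) i 0) (V s).
  by move=> sh; rewrite addSn addnS; apply: dyn; lia.
have Xs := @tilt_iter _ (fun s => submxrow (x (t1.+1 + s)%N) i 0) V h.+1 d0 XV.
rewrite (eq_wnorm r (v := fun s => tilt (submxrow (x (t1.+1 + 0)%N) i 0)
    (fun j => \sum_(0 <= q < s) V q j) j)); last first.
  by move=> s sh; rewrite -(Xs s sh) submxrowE.
apply: le_trans (wnorm_tilt j r0 d0 a12 _) _; last first.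
  by rewrite mulrC submxrowE ler_wpM2l ?ler_norm // invr_ge0; lra.
move=> l; apply: le_trans etaa.
have Vdiff : fdiff (fun s => \sum_(0 <= q < s) V q l) = V^~ l.
  apply/funext => s; rewrite /fdiff big_nat_recr //=.
  by rewrite addrAC subrr add0r.
have VB s : (s <= h)%N -> `|V s l| <= 3 * eta * B.
  move=> sh; rewrite /V normrM gtr0_norm // !submxrowE.
  have h1 : `|F (x (t1 + s)%N) 0 (tagnat.Rank i l)| <= B by apply: FB; lia.
  have h2 : `|F (x (t1.+1 + s)%N) 0 (tagnat.Rank i l)| <= B by apply: FB; lia.
  have -> : 3 * eta * B = eta * (3 * B) by ring.
  apply: ler_wpM2l; first exact/ltW.
  apply: le_trans (ler_normB _ _) _; rewrite normrM ger0_norm //; lra.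
have sumB s : (s <= h.+1)%N -> `|\sum_(0 <= q < s) V q l| <= 3 * eta * (H%:R * B).
  move=> sh; apply: le_trans (ler_norm_sum _ _ _) _.
  apply: (@le_trans _ _ (\sum_(0 <= q < s) (3 * eta * B))).
    by apply: ler_sum_nat => q /andP[_ qs]; apply: VB; lia.
  rewrite big_const_nat subn0 iter_addr_0 -[_ *+ s]mulr_natl.
  have -> : 3 * eta * (H%:R * B) = H%:R * (3 * eta * B) by ring.
  apply: ler_wpM2r; last by rewrite ler_nat; lia.
  by apply: mulr_ge0 => //; lra.
have HB0 : 0 <= 3 * eta * (H%:R * B) by do 2!apply: mulr_ge0 => //; lra.
apply: le_trans (wnorm_primitive r0 HB0 sumB) _; rewrite lerD2l Vdiff.
rewrite mulrCA; apply: ler_wpM2l => //.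
rewrite (eq_wnorm r (v := fun s => eta * (F (x (t1 + s)%N) 0 (tagnat.Rank i l) +
  (-2) * F (x (t1.+1 + s)%N) 0 (tagnat.Rank i l)))); last first.
  by move=> s sh; rewrite /V !submxrowE; ring.
apply: le_trans (wnormZ r0 _ _ _) _; rewrite gtr0_norm //.
rewrite [3 * eta]mulrC -mulrA; apply: ler_wpM2l; first exact/ltW.
apply: le_trans (wnormD r0 _ _ _) _.
have I1 := IH t1 (tagnat.Rank i l) ltac:(lia) ltac:(lia) ltac:(lia).
have I2 := IH t1.+1 (tagnat.Rank i l) ltac:(lia) ltac:(lia) ltac:(lia).
have I3 := wnormZ r0 h (-2) (fun s => F (x (t1.+1 + s)%N) 0 (tagnat.Rank i l)).
rewrite normrN ger0_norm // in I3; lra.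
Qed.

End HighOrderSmoothness.

(** * Total variation of the losses *)

Section Variation.
Context {R : realType}.

Context {J : finType}.
Implicit Types (p v : J -> R).

Lemma tilt_ratio p v (b : R) j : distr p -> (forall k, `|v k| <= b) ->
  p j <= expR (2 * b) * tilt p v j /\ tilt p v j <= expR (2 * b) * p j.
Proof.
move=> dp vb; case: (dp) => p0 p1; have Z0 := tilt_sum_gt0 v dp.
have ZU : \sum_k p k * expR (v k) <= expR b.
  rewrite -[leRHS]mul1r -[X in X * _]p1 mulr_suml; apply: ler_sum => k _.
  apply: ler_wpM2l; first exact/ltW.
  by rewrite ler_expR; apply: le_trans (ler_norm _) (vb k).
have ZL : expR (- b) <= \sum_k p k * expR (v k).
  rewrite -[leLHS]mul1r -[X in X * _]p1 mulr_suml; apply: ler_sum => k _.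
  apply: ler_wpM2l; first exact/ltW.
  by rewrite ler_expR; have := vb k; rewrite ler_norml => /andP[].
have := vb j; rewrite ler_norml => /andP[vl vu].
rewrite /tilt; set Z := \sum_k _ in Z0 ZU ZL *; split.
  have -> : expR (2 * b) * (p j * expR (v j) / Z) =
      p j * (expR (2 * b) * expR (v j)) / Z by ring.
  rewrite ler_pdivlMr //; apply: ler_wpM2l; first exact/ltW.
  by apply: le_trans ZU _; rewrite -expRD ler_expR; lra.
rewrite ler_pdivrMr //.
have -> : expR (2 * b) * p j * Z = p j * (expR (2 * b) * Z) by ring.
apply: ler_wpM2l; first exact/ltW.
apply: (@le_trans _ _ (expR (2 * b) * expR (- b))).
  by rewrite -expRD ler_expR; lra.
by rewrite ler_wpM2l ?expR_ge0.
Qed.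

(** One tilt multiplies a weight by a factor between [expR (- 2 b)] and [expR (2 b)],
    hence a pair weight by one between [expR (- 4 b)] and [expR (4 b)]. *)
Lemma tilt_pair_weights p v (b : R) i j : distr p -> (forall k, `|v k| <= b) ->
  12 * b <= 1 ->
  `|p i * p j - tilt p v i * tilt p v j| <= 8 * b * (tilt p v i * tilt p v j).
Proof.
move=> dp vb b12; have b0 : 0 <= b := le_trans (normr_ge0 _) (vb i).
have [i1 i2] := tilt_ratio i dp vb; have [j1 j2] := tilt_ratio j dp vb.
have [q0 _] := tilt_distr v dp.
have pi0 : 0 <= p i by apply/ltW/dp.1.
have pj0 : 0 <= p j by apply/ltW/dp.1.
set a := tilt p v i in i1 i2 *; set c := tilt p v j in j1 j2 *.
have a0 : 0 <= a := ltW (q0 i).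
have c0 : 0 <= c := ltW (q0 j).
have ac0 : 0 <= a * c by exact: mulr_ge0.
set E := expR (2 * b) in i1 i2 j1 j2.
have E2 : E * E <= 1 + 8 * b.
  rewrite /E -expRD; have -> : 2 * b + 2 * b = 4 * b by ring.
  apply: le_trans (expR_le_quad _) _; last nra.
  by rewrite ger0_norm; lra.
have up : p i * p j <= E * E * (a * c).
  have -> : E * E * (a * c) = (E * a) * (E * c) by ring.
  exact: ler_pM.
have lo : a * c <= E * E * (p i * p j).
  have -> : E * E * (p i * p j) = (E * p i) * (E * p j) by ring.
  exact: ler_pM.
have pp0 : 0 <= p i * p j by exact: mulr_ge0.
have h1 : E * E * (a * c) <= (1 + 8 * b) * (a * c) by exact: ler_wpM2r.
have h2 : E * E * (p i * p j) <= (1 + 8 * b) * (p i * p j) by exact: ler_wpM2r.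
rewrite ler_norml; apply/andP; split; last lra.
have [ge|/ltW le] := leP (a * c) (p i * p j).
  have : 0 <= 8 * b * (a * c) by apply: mulr_ge0 => //; lra.
  lra.
have : 8 * b * (p i * p j) <= 8 * b * (a * c) by apply: ler_wpM2l => //; lra.
lra.
Qed.

Lemma fvariance_le p v (b : R) : distr p -> (forall j, `|v j| <= b) ->
  fvariance p v <= 2 * b ^+ 2.
Proof.
move=> [p0 p1] vb.
have -> : 2 * b ^+ 2 = 2^-1 * \sum_i \sum_j p i * p j * (2 * b) ^+ 2.
  rewrite (eq_bigr (fun i => p i * (2 * b) ^+ 2)) => [|i _].
    by rewrite -mulr_suml p1; field.
  rewrite (eq_bigr (fun j => (p i * (2 * b) ^+ 2) * p j)) => [|j _]; last by ring.
  by rewrite -mulr_sumr p1 mulr1.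
rewrite ler_wpM2l ?invr_ge0 //; apply: ler_sum => i _; apply: ler_sum => j _.
apply: ler_wpM2l; first by apply: mulr_ge0; exact/ltW.
rewrite -[leLHS]ger0_norm ?sqr_ge0 // normrX.
have vij : `|v i - v j| <= 2 * b.
  by apply: le_trans (ler_normB _ _) _; have := vb i; have := vb j; lra.
by apply: lerXn2r; rewrite ?nnegrE // (le_trans _ vij).
Qed.

Lemma fvariance_pair p v :
  fvariance p v = 2^-1 * \sum_(ij : J * J) p ij.1 * p ij.2 * (v ij.1 - v ij.2) ^+ 2.
Proof.
by rewrite /fvariance (pair_bigA _ (fun i j => p i * p j * (v i - v j) ^+ 2)).
Qed.

(** The interpolation applied to the pairwise differences of the losses from time H
    on.  The first H terms and the last one, which are not covered, are bounded
    trivially by [8 B ^ 2] each. *)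
Lemma variation_bound (L X V : nat -> J -> R) (B b : R) (H T : nat) :
  0 <= B -> (1 <= H <= T)%N -> (T <= 4 ^ H)%N ->
  0 <= b -> 384 * b * H%:R <= 1 ->
  (forall t j, (t <= T)%N -> `|L t j| <= B) ->
  (forall t, (t <= T)%N -> distr (X t)) ->
  (forall t, (1 <= t)%N -> (t < T)%N -> X t.+1 =1 tilt (X t) (V t)) ->
  (forall t j, (1 <= t)%N -> (t < T)%N -> `|V t j| <= b) ->
  (forall h t j, (h <= H)%N -> (H <= t)%N -> (t + h <= T)%N ->
     `|iter h fdiff (L^~ j) t| <= 2 * B * 32^-1 ^+ h) ->
  \sum_(0 <= t < T) (fvariance (X t.+1) (fun j => L t.+1 j - L t j) -
                     fvariance (X t.+1) (L t) / 5) <= B ^+ 2 * (8 * H%:R + 136).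
Proof.
move=> B0 /andP[H1 HT] T4 b0 bH LB dX XV Vb Ldiff.
have H1' : 1 <= H%:R :> R by rewrite ler1n.
pose m := (T - H)%N.
(* beyond time T the iterates are arbitrary, so the weights are cut off there *)
pose w s (ij : J * J) :=
  if (s < m)%N then X (H + s).+1 ij.1 * X (H + s).+1 ij.2 else 0.
pose u s (ij : J * J) := L (H + s)%N ij.1 - L (H + s)%N ij.2.
have w0 s ij : 0 <= w s ij.
  rewrite /w; case: ifP => // sm; have [d0 _] : distr (X (H + s).+1) by apply: dX; lia.
  by apply: mulr_ge0; exact/ltW.
have w1 s : \sum_ij w s ij <= 1.
  rewrite /w; case sm: (s < m)%N; last by rewrite big1_eq.
  have [_ d1] : distr (X (H + s).+1) by apply: dX; lia.
  rewrite -(pair_bigA _ (fun i j => X (H + s).+1 i * X (H + s).+1 j)) /=.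
  by rewrite (eq_bigr (X (H + s).+1)) ?d1 // => i _; rewrite -mulr_sumr d1 mulr1.
have weps s ij : (s.+1 < m)%N -> `|w s ij - w s.+1 ij| <= 8 * b * w s.+1 ij.
  move=> sm; rewrite /w sm (ltnW sm) addnS.
  have tT : ((H + s).+1 < T)%N by lia.
  rewrite !(XV _ (ltn0Sn _) tT); apply: tilt_pair_weights.
  - by apply: dX; lia.
  - by move=> k; apply: Vb.
  - nra.
have uM h s ij : (h <= H)%N -> (s + h < m)%N ->
    `|iter h fdiff (fun t => u t ij) s| <= 4 * B * 32^-1 ^+ h.
  move=> hH sm.
  have -> : iter h fdiff (fun t => u t ij) s =
      iter h fdiff (L^~ ij.1) (H + s)%N - iter h fdiff (L^~ ij.2) (H + s)%N.
    rewrite -!fdiff_shift -mulN1r -fdiffZ -fdiffD.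
    by apply: eq_fdiff => k _; rewrite mulN1r.
  apply: le_trans (ler_normB _ _) _.
  have i1 := Ldiff h (H + s)%N ij.1 hH ltac:(lia) ltac:(lia).
  have i2 := Ldiff h (H + s)%N ij.2 hH ltac:(lia) ltac:(lia).
  have -> : 4 * B * 32^-1 ^+ h = 2 * B * 32^-1 ^+ h + 2 * B * 32^-1 ^+ h by ring.
  exact: lerD.
have e0 : 0 <= 8 * b by lra.
have eH : 48 * (8 * b) * H%:R <= 1 by lra.
have mH : (m <= 4 ^ H)%N by rewrite /m; lia.
have M0 : 0 <= 4 * B by lra.
have contr := energy_contraction e0 eH mH M0 w0 w1 weps uM H1.
have E0 : energy w u m 0 = 2 * \sum_(0 <= s < m) fvariance (X (H + s).+1) (L (H + s)%N).
  rewrite /energy subn0 mulr_sumr; apply: eq_big_nat => s /andP[_ sm].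
  rewrite fvariance_pair mulrA divff // mul1r; apply: eq_bigr => ij _.
  by rewrite /w sm.
have E1 : energy w u m 1 = 2 * \sum_(0 <= s < m.-1)
    fvariance (X (H + s).+1) (fun j => L (H + s).+1 j - L (H + s)%N j).
  rewrite /energy subn1 mulr_sumr; apply: eq_big_nat => s /andP[_ sm].
  rewrite fvariance_pair mulrA divff // mul1r; apply: eq_bigr => ij _.
  have -> : (w s ij) = X (H + s).+1 ij.1 * X (H + s).+1 ij.2.
    by rewrite /w; case: ifP => //; lia.
  by rewrite /= /fdiff /u addnS; congr (_ * _ ^+ 2); ring.
have var_le t : (t < T)%N ->
    fvariance (X t.+1) (fun j => L t.+1 j - L t j) <= 8 * B ^+ 2.
  move=> tT; have -> : 8 * B ^+ 2 = 2 * (2 * B) ^+ 2 by ring.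
  apply: fvariance_le => [|j]; first exact: dX.
  apply: le_trans (ler_normB _ _) _.
  by have := LB t j (ltnW tT); have := LB t.+1 j tT; lra.
have var_ge0 t : (t < T)%N -> 0 <= fvariance (X t.+1) (L t).
  by move=> tT; apply: fvariance_ge0 => j; apply/ltW; exact: (dX _ tT).1.
rewrite (@big_cat_nat _ _ _ H) //=.
have part1 : \sum_(0 <= t < H) (fvariance (X t.+1) (fun j => L t.+1 j - L t j) -
    fvariance (X t.+1) (L t) / 5) <= H%:R * (8 * B ^+ 2).
  apply: (@le_trans _ _ (\sum_(0 <= t < H) (8 * B ^+ 2))).
    apply: ler_sum_nat => t /andP[_ tH]; have tT : (t < T)%N by lia.
    by have := var_le t tT; have := var_ge0 t tT; lra.
  by rewrite big_const_nat subn0 iter_addr_0 -[_ *+ H]mulr_natl.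
have part2 : \sum_(H <= t < T) (fvariance (X t.+1) (fun j => L t.+1 j - L t j) -
    fvariance (X t.+1) (L t) / 5) <= 136 * B ^+ 2.
  rewrite -{1}[H]add0n big_addn -/m.
  rewrite (eq_bigr (fun s => fvariance (X (H + s).+1)
     (fun j => L (H + s).+1 j - L (H + s)%N j) -
     5^-1 * fvariance (X (H + s).+1) (L (H + s)%N))); last first.
    by move=> s _; rewrite addnC [5^-1 * _]mulrC.
  rewrite sumrB -[X in _ - X]mulr_sumr.
  have S0 : 0 <= \sum_(0 <= s < m) fvariance (X (H + s).+1) (L (H + s)%N).
    rewrite big_nat_cond; apply: sumr_ge0 => s /andP[/andP[_ sm] _].
    by apply: var_ge0; lia.
  have last_term : \sum_(0 <= s < m) fvariance (X (H + s).+1)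
      (fun j => L (H + s).+1 j - L (H + s)%N j) <= 8 * B ^+ 2 +
      \sum_(0 <= s < m.-1) fvariance (X (H + s).+1)
      (fun j => L (H + s).+1 j - L (H + s)%N j).
    case Em : m => [|m'] /=.
      by rewrite !big_geq // addr0 mulr_ge0 ?sqr_ge0.
    by rewrite big_nat_recr //= addrC lerD2r; apply: var_le; lia.
  have M2 : (4 * B) ^+ 2 = 16 * B ^+ 2 by ring.
  by rewrite M2 E0 E1 in contr; lra.
apply: le_trans (lerD part1 part2) _.
by rewrite le_eqVlt; apply/orP; left; apply/eqP; ring.
Qed.

End Variation.

(** * Numerical constants *)

Lemma fact_le_exp m h : (h <= m)%N -> (h`! <= m ^ h)%N.
Proof.
elim: h => [//|h IH] hH; rewrite factS expnS; apply: leq_mul => //.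
exact: IH (ltnW hH).
Qed.

Section Constants.
Context {R : realType}.

Lemma expR1_ge2 : 2 <= expR 1 :> R.
Proof. exact: expR_ge1Dx. Qed.

(** Makes [T <= expR H <= 4 ^ H], and [2 <= H] when [4 <= T]. *)
Lemma expR1_lt4 : expR 1 < 4 :> R.
Proof.
have -> : expR 1 = expR (1 / 3) ^+ 3 :> R.
  by rewrite !exprS expr0 mulr1 -!expRD; congr expR; field.
have h : expR (1 / 3) <= 1 + 1 / 3 + (1 / 3) ^+ 2 :> R.
  by apply: expR_le_quad; rewrite ger0_norm //; lra.
apply: (@le_lt_trans _ _ ((1 + 1 / 3 + (1 / 3) ^+ 2) ^+ 3)); last lra.
by apply: lerXn2r; rewrite ?nnegrE ?expR_ge0 //; lra.
Qed.

Lemma ceil_ln_spec (T : nat) : (4 <= T)%N ->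
  exists H : nat, [/\ (2 <= H <= T)%N, (T <= 4 ^ H)%N &
    (Num.ceil (ln (T%:R : R)))%:~R = H%:R :> R].
Proof.
move=> T4; have T4R : 4 <= T%:R :> R by rewrite (ler_nat R 4).
have T0 : 0 < T%:R :> R by lra.
have lnT1 : 1 < ln (T%:R : R).
  by rewrite -ltr_expR lnK ?posrE //; exact: lt_le_trans expR1_lt4 T4R.
set c := Num.ceil _.
have c1 : ln (T%:R : R) <= c%:~R by exact: ceil_ge.
have c2 : (1 < c)%R by rewrite ceil_gt_int.
have c3 : (c <= T%:Z)%R by rewrite ceil_le_int; exact: ltW (ln_sublinear T0).
exists `|c|%N; have cE : c = `|c|%N%:Z by lia.
have cR : c%:~R = `|c|%N%:R :> R by rewrite {1}cE.
split=> //; first lia.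
rewrite -(ler_nat R) natrX -(lnK (_ : T%:R \is Num.pos)) ?posrE //.
apply: (@le_trans _ _ (expR `|c|%N%:R)); first by rewrite ler_expR -cR.
rewrite -[X in expR X]mulr1 expRM_natl; apply: lerXn2r.
- by rewrite nnegrE expR_ge0.
- by rewrite nnegrE.
- exact/ltW/expR1_lt4.
Qed.

Lemma beta_bounds (H Theta : R) : 2 <= H -> 1 <= Theta ->
  let beta0 := 1 / (4 * H) in
  let beta := Num.min (Num.sqrt (beta0 / 8) / H ^+ 3) (1 / (2 * Theta * (H + 3))) in
  [/\ 0 < beta, beta <= 1, H * beta <= 32^-1 & 2 * Theta * H * beta <= 1].
Proof.
move=> H2 Th1 beta0 beta.
have H0 : 0 < H by lra.
have H3 : 0 < H ^+ 3 by exact: exprn_gt0.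
have b0 : 0 < beta0 by rewrite /beta0 divr_gt0 //; lra.
have D0 : 0 < 2 * Theta * (H + 3) by apply: mulr_gt0; lra.
have beta_gt0 : 0 < beta.
  by rewrite lt_min !divr_gt0 ?sqrtr_gt0 //; lra.
have s8 : Num.sqrt (beta0 / 8) <= 1 / 8.
  have e8 : 1 / 8 = Num.sqrt ((1 / 8) ^+ 2) :> R.
    by rewrite sqrtr_sqr ger0_norm //; lra.
  rewrite e8; apply: ler_wsqrtr; rewrite /beta0.
  have -> : 1 / (4 * H) / 8 = 1 / (32 * H) by field; lra.
  by rewrite ler_pdivrMr; nra.
have b1 : beta * H ^+ 3 <= 1 / 8.
  rewrite -ler_pdivlMr //; apply: (@le_trans _ _ (Num.sqrt (beta0 / 8) / H ^+ 3)).
    by rewrite ge_min lexx.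
  by rewrite ler_pM2r ?invr_gt0.
have b2 : beta * (2 * Theta * (H + 3)) <= 1.
  by rewrite -ler_pdivlMr // ge_min lexx orbT.
have HH : 4 <= H ^+ 2 by nra.
have b3 : (beta * H) * H ^+ 2 <= 1 / 8 by rewrite -mulrA -exprS.
have bH0 : 0 <= beta * H by rewrite ltW // mulr_gt0.
have b4 : beta * H * 4 <= 1 / 8 by apply: le_trans b3; apply: ler_wpM2l.
split=> //.
- by have : beta * 2 <= beta * H by [rewrite ler_pM2l]; lra.
- lra.
- have : 0 <= beta * (6 * Theta) by rewrite ltW // mulr_gt0 //; lra.
  by lra.
Qed.

(** Taking logarithms, the choice of K gives
    [Theta1 theta ^ K <= (beta / 4) ^ H]; the factor 2 gained over [2 / beta] is
    what makes the sum over the orders of differences converge. *)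
Lemma remainder_decay (theta Theta1 beta Khat0 : R) (H K : nat) :
  0 <= theta < 1 -> 0 < Theta1 -> 0 < beta -> beta <= 1 -> (0 < K)%N ->
  Khat0 = (if theta == 0 then 0
    else (H%:R * ln (4 * beta^-1) + ln Theta1) / ln theta^-1) ->
  Khat0 <= K%:R ->
  forall k, (k <= H)%N -> Theta1 * theta ^+ K * (2 * beta^-1) ^+ k <= 2^-1 ^+ k.
Proof.
move=> /andP[t0 t1] Th1 b0 b1 K0 -> KK k kH.
have bV : 1 <= beta^-1 by rewrite invf_ge1.
have [tz|tnz] := eqVneq theta 0.
  by rewrite tz expr0n (gtn_eqF K0) mulr0 mul0r exprn_ge0 // invr_ge0.
rewrite (negbTE tnz) in KK.
have tpos : 0 < theta by rewrite lt_neqAle eq_sym tnz.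
have lt0 : 0 < ln theta^-1 by rewrite ln_gt0 // invf_gt1.
rewrite ler_pdivrMr // lnV ?posrE // in KK.
have q1 : 1 <= 4 * beta^-1 by lra.
have q0 : 0 < 4 * beta^-1 by lra.
have big : Theta1 * theta ^+ K * (4 * beta^-1) ^+ H <= 1.
  have P0 : 0 < Theta1 * theta ^+ K * (4 * beta^-1) ^+ H.
    by rewrite !mulr_gt0 // exprn_gt0.
  rewrite -ler_ln ?posrE // ln1.
  have tK0 : 0 < theta ^+ K by exact: exprn_gt0.
  have qH0 : 0 < (4 * beta^-1) ^+ H by exact: exprn_gt0.
  rewrite lnM ?posrE ?mulr_gt0 // [ln (_ * theta ^+ K)]lnM ?posrE // !lnXn //.
  rewrite -[ln theta *+ K]mulr_natl -[_ *+ H]mulr_natl; lra.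
have e2 : 2 * beta^-1 = (4 * beta^-1) * 2^-1 by field; rewrite gt_eqF.
rewrite e2 exprMn mulrA; apply: ler_piMl; first by rewrite exprn_ge0 // invr_ge0.
apply: le_trans big; apply: ler_wpM2l; last exact: ler_weXn2l.
by apply: mulr_ge0; [exact/ltW|exact: exprn_ge0].
Qed.

(** The first entry of the step size makes [eta / beta] at most of order 1 / (Khat Theta), for
    the smoothness; the second makes [eta Theta H] small, for the slow variation of
    the weights.  C1 and C2 stand for numerical constants. *)
Lemma step_size_bounds (C1 C2 : nat) (H beta Khat Theta Theta2 : R) :
  (0 < C2)%N ->
  2 <= H -> 1 <= Theta -> 0 < beta -> 1 <= Khat -> 0 < Theta2 ->
  let beta0 := 1 / (4 * H) in
  let Gamma := expR 1 ^+ 2 + C1%:R * Theta2 in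
  let eta := Num.min
    (beta / (6 * expR 1 ^+ 3 * Khat * Gamma * Num.max Theta 1))
    (beta0 ^+ 4 / (C2%:R * Theta)) in
  [/\ 0 < eta, eta * beta^-1 * (192 * Khat * Theta) <= 1 &
      384 * (3 * eta * Theta) * H <= 1].
Proof.
move=> C20 H2 Th1 b0 K1 T20 beta0 G eta.
have E2 := expR1_ge2.
have G4 : 4 <= G.
  have : 0 <= C1%:R * Theta2 by rewrite mulr_ge0 // ltW.
  have : 2 * 2 <= expR 1 ^+ 2 :> R by rewrite expr2 ler_pM.
  rewrite /G; lra.
have E8 : 8 <= expR 1 ^+ 3 :> R.
  have -> : 8 = 2 ^+ 3 :> R by lra.
  by apply: lerXn2r; rewrite ?nnegrE //; lra.
pose mx := Num.max Theta 1.
have mxT : Theta <= mx by rewrite le_max lexx.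
pose D := 6 * expR 1 ^+ 3 * Khat * G * mx.
have DL : 192 * Khat * Theta <= D.
  have -> : 192 * Khat * Theta = 6 * 8 * Khat * 4 * Theta by ring.
  rewrite /D; do 4?[apply: ler_pM => //; rewrite ?mulr_ge0 //; try lra].
have D0 : 0 < D.
  by apply: lt_le_trans DL; rewrite !mulr_gt0 //; lra.
have b00 : 0 < beta0 by rewrite /beta0 divr_gt0 //; lra.
have c1 : 1 <= C2%:R :> R by rewrite ler1n.
have D20 : 0 < C2%:R * Theta by apply: mulr_gt0; lra.
have eta0 : 0 < eta by rewrite lt_min !divr_gt0 // exprn_gt0.
have D1 : eta * D <= beta by rewrite -ler_pdivlMr // ge_min lexx.
have D2 : eta * (C2%:R * Theta) <= beta0 ^+ 4.
  by rewrite -ler_pdivlMr // ge_min lexx orbT.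
have h1 : eta * Theta <= beta0 ^+ 4.
  apply: le_trans D2; apply: ler_wpM2l; first exact/ltW.
  by apply: ler_peMl; lra.
have bH : beta0 * H = 4^-1 by rewrite /beta0; field; lra.
have b8 : beta0 <= 8^-1.
  by rewrite /beta0 ler_pdivrMr; lra.
have b3 : beta0 ^+ 3 <= 8^-1 ^+ 3.
  by apply: lerXn2r; rewrite ?nnegrE; lra.
have h2 : eta * Theta * H <= beta0 ^+ 3 * 4^-1.
  rewrite -bH mulrA -exprSr; apply: ler_wpM2r => //; lra.
split; [exact: eta0| |].
  have -> : eta * beta^-1 * (192 * Khat * Theta) = eta * (192 * Khat * Theta) / beta.
    by ring.
  rewrite ler_pdivrMr ?mul1r; last exact: b0.
  by apply: le_trans D1; apply: ler_wpM2l; [exact/ltW|exact: DL].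
by clear -h2 b3; lra.
Qed.

End Constants.

(** * Optimistic mirror descent *)

Section OptimisticMirrorDescent.
Context {R : realType} {d : nat} {n : 'I_d -> nat}.
Local Notation point := 'rV[R]_(\sum_i n i).
Context (F : point -> point) (eta : R) (T : nat) (x g : nat -> point).
Context (n_gt0 : forall i, (0 < n i)%N).
Context (omd : omd_iterates F eta T x g).

Local Notation X t i := (submxrow (x t) i 0).
Local Notation G t i := (submxrow (g t) i 0).
Local Notation L t i := (submxrow (F (x t)) i 0).

Lemma uniform_distr i : distr ((const_mx (n i)%:R^-1 : 'rV[R]_(n i)) 0).
Proof.
have n0 : 0 < (n i)%:R :> R by rewrite ltr0n.
split=> [j|]; first by rewrite mxE invr_gt0.
under eq_bigr => j _ do rewrite mxE.
by rewrite sumr_const card_ord -[_ *+ _]mulr_natl divff // gt_eqF.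
Qed.

Lemma omd_g_distr t i : (t <= T)%N -> distr (G t i).
Proof.
elim: t => [|t IH] tT; first by rewrite (omd.1 i).2; exact: uniform_distr.
have [_ sg] := omd.2 t.+1 (ltac:(lia)) i.
apply: eq_distr (mirror_step_tilt (IH (ltnW tT)) sg) _.
by apply: tilt_distr; exact: IH (ltnW tT).
Qed.

Lemma omd_g_tilt t i : (t < T)%N ->
  G t.+1 i =1 tilt (G t i) (fun j => - (eta * L t.+1 i j)).
Proof.
move=> tT; have [_ sg] := omd.2 t.+1 (ltac:(lia)) i.
exact: mirror_step_tilt (omd_g_distr i (ltnW tT)) sg.
Qed.

Lemma omd_x_tilt t i : (t < T)%N ->
  X t.+1 i =1 tilt (G t i) (fun j => - (eta * L t i j)).
Proof.
move=> tT; have [sx _] := omd.2 t.+1 (ltac:(lia)) i.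
exact: mirror_step_tilt (omd_g_distr i (ltnW tT)) sx.
Qed.

Lemma omd_x_distr t i : (t <= T)%N -> distr (X t i).
Proof.
case: t => [|t] tT; first by rewrite (omd.1 i).1; exact: uniform_distr.
have dg := omd_g_distr i (ltnW tT).
exact: eq_distr (@omd_x_tilt _ i tT) (tilt_distr _ dg).
Qed.

(** Both [x t.+2] and [x t.+1] are tilts of the same [g t]; hence a recursion in x
    alone, in which the optimistic correction shows as [2 l_(t+1) - l_t]. *)
Lemma omd_x_step t i : (t.+2 <= T)%N ->
  X t.+2 i =1 tilt (X t.+1 i) (fun j => eta * (L t i j - 2 * L t.+1 i j)).
Proof.
move=> tT j; have dg := omd_g_distr i (ltnW (ltnW tT)).
rewrite (@omd_x_tilt _ i tT) (eq_tilt (@omd_g_tilt _ i (ltnW tT)) (frefl _)).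
rewrite tilt_tilt //.
rewrite [RHS](eq_tilt (@omd_x_tilt _ i (ltnW tT)) (frefl _)) tilt_tilt //.
by apply: eq_tilt => // k; ring.
Qed.

Lemma omd_x_simplices t : (t <= T)%N -> simplices (x t).
Proof.
by move=> tT i; have [p0 p1] := omd_x_distr i tT; split=> // j; exact/ltW.
Qed.

Context (y : point) (e0 Theta2 Theta a beta : R) (K H : nat).
Context (Theta_ge1 : 1 <= Theta) (Theta_ge : Theta2 + 1 <= Theta).
Context (eta_gt0 : 0 < eta) (beta_gt0 : 0 < beta) (a_ge0 : 0 <= a).
Context (K_gt0 : (0 < K)%N) (aK : 4 * a * K%:R <= 1).
Context (H_bound : (2 <= H <= T)%N) (T_le : (T <= 4 ^ H)%N).
Context (F_bound : forall z k, simplices z -> `|F z 0 k| <= Theta).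
Context (e0_ge0 : 0 <= e0)
  (e0_small : forall k, (k <= H)%N -> e0 * (2 * beta^-1) ^+ k <= 2^-1 ^+ k).
Context (F_remainder : forall z k, simplices z ->
  `|taylor_R (fun u => F u 0 k) K y z| <= e0).
Context (F_majorant : forall z k, simplices z ->
  taylor_P (fun u => F u 0 k) K y z <= Theta2).
Context (a_large :
  3 * eta * (H%:R * Theta) + 3 * eta * (beta^-1 * (2 * Theta)) <= a).
Context (beta_small : H%:R * beta <= 32^-1).
Context (eta_small : 384 * (3 * eta * Theta) * H%:R <= 1).

(** From the norm of parameter [r = beta^-1] to a geometric decay: a k-th
    difference is at most [2 Theta k! beta ^ k], and [k! <= H ^ k] for k <= H. *)
Lemma omd_loss_differences h t k : (h <= H)%N -> (H <= t)%N -> (t + h <= T)%N ->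
  `|iter h fdiff (fun s => F (x s) 0 k) t| <= 2 * Theta * 32^-1 ^+ h.
Proof.
move=> hH Ht tT.
have r0 : 0 <= beta^-1 by rewrite invr_ge0 ltW.
have K1 : 1 <= K%:R :> R by rewrite ler1n.
have a12 : a < 1 / 2.
  have : a * 1 <= a * K%:R by exact: ler_wpM2l.
  have := aK; lra.
have bound : wnorm beta^-1 h (fun s => F (x (t + s)%N) 0 k) <= 2 * Theta.
  apply: (@finite_difference_bound R d n F x beta^-1 eta (2 * Theta) Theta a H T
    r0 eta_gt0 a12 _ _ a_large) => //; last by lia.
  - by have := Theta_ge1; lra.
  - by have := Theta_ge1; lra.
  - move=> z h' k' h'H sz za.
    apply: le_trans (@wnorm_comp_analytic _ _ beta^-1 a e0 Theta2 K H h'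
      (fun u => F u 0 k') y z r0 a_ge0 K_gt0 aK h'H za e0_ge0 e0_small _ _) _.
    + by move=> s sh; apply: F_remainder; exact: sz.
    + by apply: F_majorant; exact: sz.
    + by have := Theta_ge; lra.
  - by move=> t' i; exact: omd_x_distr.
  - by move=> t' k' tT'; apply: F_bound; exact: omd_x_simplices.
  - by move=> t' i; exact: omd_x_step.
have le1 := le_trans (@fdiff_le_wnorm R beta^-1 r0 h
  (fun s => F (x (t + s)%N) 0 k) h 0 (leqnn h)) bound.
rewrite (fdiff_shift h t (fun s => F (x s) 0 k)) addn0 in le1.
set D := `|_| in le1 *.
have f0 : 0 < h`!%:R :> R by rewrite ltr0n fact_gt0.
have b0 : 0 < beta ^+ h by exact: exprn_gt0.
have le2 : D <= 2 * Theta * (h`!%:R * beta ^+ h).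
  rewrite -ler_pdivrMr; last by rewrite mulr_gt0.
  have -> : D / (h`!%:R * beta ^+ h) = beta^-1 ^+ h / h`!%:R * D.
    by rewrite exprVn invfM; ring.
  exact: le1.
apply: le_trans le2 _; apply: ler_wpM2l; first by have := Theta_ge1; lra.
apply: (@le_trans _ _ ((H%:R * beta) ^+ h)).
  rewrite exprMn; apply: ler_wpM2r; first exact/ltW.
  by rewrite -natrX ler_nat fact_le_exp.
by apply: lerXn2r; rewrite ?nnegrE ?invr_ge0 // mulr_ge0 // ltW.
Qed.

(** The sum of variances of [omd_regret] is the one of [variation_bound]; one step
    changes the logarithms of the weights by at most [3 eta Theta]. *)
Lemma omd_block_regret (s : point) i : simplices s ->
  \sum_(0 <= t < T) \sum_j L t.+1 i j * (X t.+1 i j - submxrow s i 0 j) <=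
  eta^-1 * ln (n i)%:R + eta * (Theta ^+ 2 * (8 * H%:R + 136)).
Proof.
move=> ss; have H2 : 2 <= H%:R :> R by rewrite (ler_nat R 2); case/andP: H_bound.
have eT0 : 0 <= eta * Theta.
  by apply: mulr_ge0; [exact/ltW|by have := Theta_ge1; lra].
have eT : eta * Theta * 2 <= eta * Theta * H%:R by exact: ler_wpM2l.
have eta12 : 12 * (eta * Theta) <= 1 by have := eta_small; lra.
have LB t j : (t <= T)%N -> `|L t i j| <= Theta.
  by move=> tT; rewrite submxrowE; apply: F_bound; exact: omd_x_simplices.
have [s0 s1] := ss i.
have G0 j : G 0%N i j = #|'I_(n i)|%:R^-1.
  by rewrite (omd.1 i).2 mxE card_ord.
have reg := @omd_regret R 'I_(n i) eta Theta T (fun t => L t i) (fun t => X t i)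
  (fun t => G t i) (submxrow s i 0) eta_gt0 eta12 LB G0
  (fun t => @omd_x_tilt t i) (fun t => @omd_g_tilt t i)
  (fun t => @omd_g_distr t i) s0 s1.
have var : \sum_(0 <= t < T) (fvariance (X t.+1 i) (fun j => L t.+1 i j - L t i j) -
    fvariance (X t.+1 i) (L t i) / 5) <= Theta ^+ 2 * (8 * H%:R + 136).
  apply: (@variation_bound R 'I_(n i) (fun t => L t i) (fun t => X t i)
    (fun t j => eta * (L t.-1 i j - 2 * L t i j)) Theta (3 * eta * Theta) H T) => //.
  - by have := Theta_ge1; lra.
  - by case/andP: H_bound => h1 h2; apply/andP; split => //; exact: ltnW.
  - by rewrite -mulrA; apply: mulr_ge0.
  - by move=> t; exact: omd_x_distr.
  - by case=> // t _ tT; exact: omd_x_step.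
  - move=> t j t1 tT; rewrite normrM gtr0_norm //.
    have -> : 3 * eta * Theta = eta * (3 * Theta) by ring.
    apply: ler_wpM2l; first exact/ltW.
    apply: le_trans (ler_normB _ _) _; rewrite normrM ger0_norm //.
    have h1 := LB t.-1 j (leq_trans (leq_pred t) (ltnW tT)).
    have h2 := LB t j (ltnW tT); lra.
  - move=> h t j hH Ht tT.
    rewrite (_ : (fun s => L s i j) = (fun s => F (x s) 0 (tagnat.Rank i j))).
      exact: omd_loss_differences.
    by apply/funext => s'; rewrite submxrowE.
rewrite -(ler_pM2l eta_gt0); apply: le_trans reg _.
rewrite card_ord [leRHS]mulrDr mulVKf ?gt_eqF // lerD2l [leRHS]mulrA -expr2.
by apply: ler_wpM2l; [exact: sqr_ge0|exact: var].
Qed.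

Lemma omd_average_gap f xstar gamma : gqc f xstar F gamma ->
  T%:R^-1 * (\sum_(1 <= t < T.+1) (f (x t) - f xstar)) <=
  (\sum_i (gamma i)^-1) *
    (eta^-1 * ln (\max_i n i)%N%:R + eta * (Theta ^+ 2 * (8 * H%:R + 136))) *
    T%:R^-1.
Proof.
move=> [[sstar _] gam0 gap].
rewrite mulrC; apply: ler_wpM2r; first by rewrite invr_ge0.
rewrite big_add1 /= mulr_suml.
apply: (@le_trans _ _ (\sum_(0 <= t < T) \sum_i (gamma i)^-1 *
    \sum_j L t.+1 i j * (X t.+1 i j - submxrow xstar i 0 j))).
  apply: ler_sum_nat => t /andP[_ tT].
  have := gap (x t.+1) (omd_x_simplices tT).
  rewrite -lerBrDl => h; rewrite -lerN2 opprB; apply: le_trans h.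
  rewrite -sumrN le_eqVlt; apply/orP; left; apply/eqP; apply: eq_bigr => i _.
  rewrite -mulrN /inner -sumrN; congr (_ * _); apply: eq_bigr => j _.
  by rewrite !mxE; ring.
rewrite exchange_big /=; apply: ler_sum => i _; rewrite -mulr_sumr.
apply: ler_wpM2l; first by rewrite invr_ge0 ltW.
apply: le_trans (omd_block_regret i sstar) _; rewrite lerD2r.
apply: ler_wpM2l; first by rewrite invr_ge0 ltW.
have nN : (n i <= \max_i n i)%N by exact: leq_bigmax.
by rewrite ler_ln ?posrE ?ltr0n ?ler_nat //; apply: leq_trans nN.
Qed.

End OptimisticMirrorDescent.

(** * The step size and the final constants *)

Section Closing.
Context {R : realType}.

Lemma regret_constant_le (C : nat) (Theta H : R) : (8 <= C)%N -> 1 <= Theta -> 2 <= H ->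
  Theta ^+ 2 * (8 * H + 136) <= Theta ^+ 3 * (6 + C%:R * Theta * H ^+ 5).
Proof.
move=> C8 Th1 H2.
have H4 : 16 <= H ^+ 4.
  have -> : 16 = 2 ^+ 4 :> R by ring.
  by apply: lerXn2r; rewrite ?nnegrE; lra.
have C8R : 8 <= C%:R :> R by rewrite (ler_nat R 8).
have H5 : 16 * H <= H ^+ 5.
  by rewrite [leRHS]exprSr; apply: ler_wpM2r; lra.
have CT : 8 * H ^+ 5 <= C%:R * Theta * H ^+ 5.
  apply: ler_wpM2r; first lra.
  by apply: le_trans C8R _; apply: ler_peMr => //; exact: ler0n.
rewrite (exprSr Theta 2) -mulrA; apply: ler_wpM2l; first exact: sqr_ge0.
apply: (@le_trans _ _ (1 * (6 + C%:R * Theta * H ^+ 5))); first lra.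
by apply: ler_wpM2r; lra.
Qed.

(** The parameter a of the high-order smoothness is taken to be 1 / (25 Khat): large
    enough for the exponents on a window, small enough for powers of degree K,
    as K <= 2 Khat. *)
Lemma smoothness_budget (eta beta Theta Khat H K : R) :
  0 < eta -> 0 < beta -> 1 <= Theta -> 1 <= Khat -> K <= 2 * Khat ->
  2 * Theta * H * beta <= 1 ->
  eta * beta^-1 * (192 * Khat * Theta) <= 1 ->
  3 * eta * (H * Theta) + 3 * eta * (beta^-1 * (2 * Theta)) <= (25 * Khat)^-1 /\
  4 * (25 * Khat)^-1 * K <= 1.
Proof.
move=> e0 b0 Th1 K1 KK bT eK; split; last first.
  by rewrite mulrAC ler_pdivrMr; lra.
have bV : 2 * Theta * H <= beta^-1 by rewrite -div1r ler_pdivlMr.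
have eb : 0 <= eta * beta^-1 by rewrite mulr_ge0 ?invr_ge0 ?ltW.
have h1 : eta * (2 * Theta * H) <= eta * beta^-1 * Theta.
  apply: (@le_trans _ _ (eta * beta^-1)); first by rewrite ler_pM2l.
  exact: ler_peMr.
rewrite -[(25 * Khat)^-1]div1r ler_pdivlMr; last lra.
set q := eta * beta^-1 * Theta in h1.
have qK : q * Khat <= 192^-1.
  rewrite -[192^-1]div1r ler_pdivlMr //; apply: le_trans eK.
  by rewrite le_eqVlt; apply/orP; left; apply/eqP; rewrite /q; ring.
have -> : 3 * eta * (H * Theta) = 3 * (eta * (2 * Theta * H)) / 2 by field.
have -> : 3 * eta * (beta^-1 * (2 * Theta)) = 6 * q by rewrite /q; ring.
have h2 : (3 * (eta * (2 * Theta * H)) / 2 + 6 * q) * (25 * Khat) <=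
    15 / 2 * q * (25 * Khat) by apply: ler_wpM2r; lra.
by lra.
Qed.

End Closing.

Theorem theorem3p5 (R : realType) (d : nat) (n : 'I_d -> nat)
    (f : 'rV[R]_(\sum_i n i) -> R) (xstar : 'rV[R]_(\sum_i n i))
    (F : 'rV[R]_(\sum_i n i) -> 'rV[R]_(\sum_i n i)) (gamma : 'I_d -> R)
    (y : 'rV[R]_(\sum_i n i)) (U : set 'rV[R]_(\sum_i n i))
    (Theta1 Theta2 theta : R) (K0 T : nat)
    (x g : nat -> 'rV[R]_(\sum_i n i)) :
  gqc f xstar F gamma ->
  open U -> @simplices R d n `<=` U -> U y ->
  (forall j, smooth_on U (fun z => F z 0 j)) ->
  0 < Theta1 -> 0 < Theta2 -> (0 < K0)%N -> 0 <= theta < 1 ->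
  (forall K : nat, (K0 < K)%N -> forall z, @simplices R d n z ->
     `|taylor_Rvec F K y z| <= Theta1 * theta ^+ K) ->
  (forall K : nat, (0 < K)%N -> forall z, @simplices R d n z ->
     `|taylor_Pvec F K y z| <= Theta2) ->
  (4 <= T)%N ->
  let N := (\max_i n i)%N in
  let Theta := Theta1 + Theta2 + 1 in
  let H : R := (Num.ceil (ln (T%:R : R)))%:~R in
  let beta0 := 1 / (4 * H) in
  let beta := Num.min (Num.sqrt (beta0 / 8) / H ^+ 3)
                      (1 / (2 * Theta * (H + 3))) in
  let Gamma := expR 1 ^+ 2 + 322560%:R * Theta2 in
  let Khat := Num.max
    (if theta == 0 then 0
     else (H * ln (4 * beta^-1) + ln Theta1) / ln theta^-1) K0%:R in
  let eta := Num.min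
    (beta / (6 * expR 1 ^+ 3 * Khat * Gamma * Num.max Theta 1))
    (beta0 ^+ 4 / (57792%:R * Theta)) in
  omd_iterates F eta T x g ->
  T%:R^-1 * (\sum_(1 <= t < T.+1) (f (x t) - f xstar)) <=
  (\sum_i (gamma i)^-1) *
    (eta^-1 * ln N%:R + eta * Theta ^+ 3 * (6 + 330240%:R * Theta * H ^+ 5)) *
    T%:R^-1.
Proof.
move=> gq _ _ _ _ Th1 Th2 K00 th rem maj T4 N Theta H beta0 beta Gamma Khat eta omd.
have [Hn [HnT T4H HE]] := @ceil_ln_spec R T T4.
have [sstar _ _] := gq; case: sstar => sstar _.
have n_gt0 i : (0 < n i)%N.
  rewrite lt0n; apply/eqP => n0; have [_] := sstar i; rewrite big1 => [/eqP|j _].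
    by rewrite eq_sym oner_eq0.
  by have := ltn_ord j; rewrite [X in (_ < X)%N]n0.
have Hn2 : 2 <= Hn%:R :> R by rewrite (ler_nat R 2); case/andP: HnT.
have HHn : H = Hn%:R by exact: HE.
have H2 : 2 <= H by rewrite HHn.
have Theta_ge1 : 1 <= Theta by rewrite /Theta; lra.
have [beta_gt0 beta_le1 betaH betaT] := beta_bounds H2 Theta_ge1.
rewrite -/beta0 -/beta in beta_gt0 beta_le1 betaH betaT.
have Khat1 : 1 <= Khat.
  by rewrite /Khat le_max; apply/orP; right; rewrite ler1n.
have [] := @step_size_bounds R 322560 57792 H beta Khat Theta Theta2
  isT H2 Theta_ge1 beta_gt0 Khat1 Th2.
rewrite -/beta0 -/Gamma -/eta => eta_gt0 etaK etaH.
(* K exceeds Khat, as the remainder needs, but not 2 Khat, as 1 <= Khat. *)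
pose K := (Num.trunc Khat).+1.
have KhatK : Khat < K%:R by exact: truncnS_gt.
have K2 : K%:R <= 2 * Khat.
  have Kt : (Num.trunc Khat)%:R <= Khat by rewrite truncn_le; lra.
  by rewrite /K -natr1; lra.
have K0K : (K0 < K)%N.
  rewrite -(ltr_nat R); apply: le_lt_trans KhatK.
  by rewrite /Khat le_max lexx orbT.
have [aL aK] := smoothness_budget eta_gt0 beta_gt0 Theta_ge1 Khat1 K2 betaT etaK.
pose e0 := Theta1 * theta ^+ K.
case/andP: (th) => th0 th1.
have e0_ge0 : 0 <= e0 by rewrite mulr_ge0 ?exprn_ge0 // ltW.
have e0_small : forall k, (k <= Hn)%N -> e0 * (2 * beta^-1) ^+ k <= 2^-1 ^+ k.
  apply: (remainder_decay th Th1 beta_gt0 beta_le1 (ltn0Sn _) erefl).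
  apply: le_trans (ltW KhatK); rewrite /Khat HHn le_max; apply/orP; left.
  exact: lexx.
have remK z k : simplices z -> `|taylor_R (fun u => F u 0 k) K y z| <= e0.
  move=> sz; apply: le_trans (rem K K0K z sz).
  by have := row_entry_le_norm (taylor_Rvec F K y z) k; rewrite mxE.
have majK z k : simplices z -> taylor_P (fun u => F u 0 k) K y z <= Theta2.
  move=> sz; apply: le_trans (maj K (ltn0Sn _) z sz).
  apply: le_trans (ler_norm _) _.
  by have := row_entry_le_norm (taylor_Pvec F K y z) k; rewrite mxE.
have Fb z k : simplices z -> `|F z 0 k| <= Theta.
  move=> sz; have h1 := taylor_poly_le (fun u => F u 0 k) K y z.
  have h2 := remK z k sz; have h3 := majK z k sz.
  have h4 : e0 <= Theta1 by rewrite ler_piMr ?exprn_ile1 // ltW.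
  have h5 := ler_normD (F z 0 k - taylor_R (fun u => F u 0 k) K y z)
    (taylor_R (fun u => F u 0 k) K y z).
  by rewrite subrK in h5; rewrite /Theta; lra.
have Theta_ge : Theta2 + 1 <= Theta by rewrite /Theta; lra.
have a_ge0 : 0 <= (25 * Khat)^-1 by rewrite invr_ge0; lra.
rewrite HHn in aL betaH etaH.
apply: le_trans (omd_average_gap n_gt0 omd Theta_ge1 Theta_ge eta_gt0 beta_gt0
  a_ge0 (ltn0Sn _) aK HnT T4H Fb e0_ge0 e0_small remK majK aL betaH etaH gq) _.
apply: ler_wpM2r; first by rewrite invr_ge0.
apply: ler_wpM2l.
  by case: gq => _ g0 _; apply: sumr_ge0 => i _; rewrite invr_ge0 ltW.
rewrite lerD2l -[leRHS]mulrA; apply: ler_wpM2l; first exact/ltW.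
rewrite HHn; exact: regret_constant_le.
Qed.
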